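(* Let $\mu$ be an independent random cascade (as defined in the context). Assume that $J=\mathbb R$ (in particular $\widetilde\tau_\mu'(1)>0$) and that there exists $A>1$ such that with probability one $A^{-1}\le W_i\le A$ for all $0\le i\le b-1$. Let $K$ be a compact subinterval of $\mathbb R$. There exist $\theta>0$ and $\delta\in(0,1)$ such that, with probability one: 1. for $j$ large enough, for every $q\in K$, $$\big|\widetilde\tau_\mu(q)-\tau_j(q)\big|\le\frac{|\log_bY_q|}{j}+\theta\,\frac{\log(j)}{j};$$ 2. for $j$ large enough, for every $n\ge j^\delta$, every $w\in\mathcal A^j$ and every $q\in K$, $$\big|\widetilde\tau_\mu(q)-\tau^w_n(q)\big|\le\frac{|\log_bY^w_q|}{n}+\theta\,\frac{\log(n)}{n},\qquad\text{with}\quad |\log Y^w_q|\le\theta\log(j).$$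
   Context: Words and intervals. Fix an integer $b\ge2$, $\mathcal A=\{0,\dots,b-1\}$, $\mathcal A^*=\bigcup_{j\ge0}\mathcal A^j$ with $\mathcal A^0=\{\emptyset\}$. $|w|$ is the length of $w$; $v\cdot w$ (or $vw$) is concatenation; $v|k$ is the prefix of length $k$ of $v$ ($v|0=\emptyset$). For $w\in\mathcal A^j$, $i(w)=\sum_{k=1}^{j}w_kb^{j-k}$ and $I_w=[i(w)b^{-j},(i(w)+1)b^{-j}]$. $t_1t_2\dots$ denotes the $b$-adic expansion of $t\in[0,1)$ and $t|k=(t_1,\dots,t_k)$. Independent random cascade. Let $W=(W_0,\dots,W_{b-1})$ be a random vector with almost surely positive components and $\sum_{k=0}^{b-1}\mathbb E(W_k)=1$, and let $(W(w))_{w\in\mathcal A^*}$ be i.i.d. copies of $W$, $W(w)=(W_0(w),\dots,W_{b-1}(w))$. For $q\in\mathbb R$ let $\widetilde\tau_\mu(q)=-\log_b\mathbb E\big(\sum_{k=0}^{b-1}W_k^q\big)\in\mathbb R\cup\{-\infty\}$. Let $J$ be the interior of the interval $\{q\in\mathbb R:\widetilde\tau_\mu'(q)q-\widetilde\tau_\mu(q)>0\}$. (The paper also considers a critical case $\widetilde\tau_\mu'(1^-)=0$, in which $J\subset(-\infty,1)$; it is excluded here by $J=\mathbb R$.) In the case $\widetilde\tau_\mu'(1^-)>0$, the independent random cascade is $\mu=\mu^\emptyset$ where, for $v\in\mathcal A^*$, $\mu^v$ is the almost sure weak limit as $j\to\infty$ of the measures $\mu^v_j$ on $[0,1]$ with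 density $b^j\prod_{k=0}^{j-1}W_{t_{k+1}}(v\cdot t|k)$ with respect to Lebesgue measure. Analyzing measures. For $q\in J$ put $W_{q,i}(w)=b^{\widetilde\tau_\mu(q)}W_i(w)^q$, and let $\mu^v_{q,j}$ be the measure on $[0,1]$ with Lebesgue density $b^j\prod_{k=0}^{j-1}W_{q,t_{k+1}}(v\cdot t|k)$. Almost surely, for all $v\in\mathcal A^*$ and all $q\in J$ simultaneously, $\mu^v_{q,j}$ converges weakly as $j\to\infty$ to a positive measure $\mu^v_q$. $Y_q^v=\Vert\mu_q^v\Vert$ is its total mass and $Y_q=Y_q^\emptyset$. For $w\in\mathcal A^*$, $n\ge1$, $q\in\mathbb R$: $\tau^w_n(q)=-\frac1n\log_b\sum_{v\in\mathcal A^n}\mu^w(I_v)^q$, and $\tau_n=\tau_n^\emptyset$. *)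

(* Defs.v *)
From HB Require Import structures.
From mathcomp Require Import all_boot all_order all_algebra.
From mathcomp Require Import all_classical all_reals all_analysis.

Set Implicit Arguments.
Unset Strict Implicit.
Unset Printing Implicit Defensive.

Import Order.TTheory GRing.Theory Num.Theory.
Import numFieldNormedType.Exports.

Local Open Scope classical_set_scope.
Local Open Scope ring_scope.

(* Mutual independence of a family of random elements: product rule over all
   finite subfamilies. *)
Definition mutually_independent (d d' : measure_display)
    (T : measurableType d) (E : measurableType d') (R : realType)
    (P : probability T R) (I : eqType) (X : I -> {mfun T >-> E}) : Prop :=
  forall (s : seq I) (B : I -> set E),
    uniq s -> (forall i, measurable (B i)) ->
    P [set x | forall i, i \in s -> B i (X i x)] =
    (\prod_(i <- s) P (X i @^-1` B i))%E.

(* Base-b logarithm with values in the extended reals, so that log 0 = -oo. *)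
Definition logb (R : realType) (b : nat) (x : \bar R) : \bar R :=
  (lne x * (ln b%:R)^-1%:E)%E.

(* The number of the b-adic interval attached to w; positions are 0-based, so
   the letter at position k has weight b ^ (|w| - k - 1). *)
Definition word_index (b : nat) (w : seq 'I_b) : nat :=
  (\sum_(k < size w) tnth (in_tuple w) k * b ^ (size w - k.+1))%N.

Definition word_interval (R : realType) (b : nat) (w : seq 'I_b) : set R :=
  [set` `[(word_index w)%:R / b%:R ^+ size w,
          (word_index w).+1%:R / b%:R ^+ size w]].

(* digit hb t k is the b-adic digit t_{k+1} of t, in the expansion that does
   not end with b-1 repeated; it is only meaningful on [0, 1[, and its value
   at the Lebesgue-null point t = 1 is irrelevant. *)
Definition digit (R : realType) (b : nat) (hb : (1 < b)%N) (t : R) (k : nat) :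
    'I_b :=
  Ordinal (ltn_pmod (Num.truncn (t * b%:R ^+ k.+1)) (ltnW hb)).

Definition prefix_of (R : realType) (b : nat) (hb : (1 < b)%N) (t : R)
    (k : nat) : seq 'I_b :=
  mkseq (digit hb t) k.

Definition cascade_density (R : realType) (b : nat) (hb : (1 < b)%N)
    (V : seq 'I_b -> 'I_b -> R) (v : seq 'I_b) (j : nat) (t : R) : R :=
  b%:R ^+ j * \prod_(k < j) V (v ++ prefix_of hb t k) (digit hb t k).

(* m restricted to [0, 1] is the weak limit of the measures on [0, 1] with
   Lebesgue densities g 0, g 1, ... *)
Definition weak_limit (R : realType) (g : nat -> R -> R)
    (m : {finite_measure set (measurableTypeR R) -> \bar R}) : Prop :=
  forall f : R -> R, {within `[0%R, 1%R], continuous f} ->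
    (\int[@lebesgue_measure R]_(t in `[0%R, 1%R]) (f t * g j t)%:E)%E
      @[j --> \oo] --> (\int[m]_(t in `[0%R, 1%R]) (f t)%:E)%E.

Definition mass (R : realType)
    (m : {finite_measure set (measurableTypeR R) -> \bar R}) : \bar R :=
  m `[0%R, 1%R]%classic.

Section structure_function.
Context (R : realType) (b : nat) (d : measure_display) (T : measurableType d).
Variables (P : probability T R) (W : T -> b.-tuple (measurableTypeR R)).

Definition ttau (q : R) : \bar R :=
  (- logb b 'E_P[fun x => (\sum_(k < b) tnth (W x) k `^ q)%R])%E.

(* ttau may take the value -oo, so ttau' q is only considered where ttau is
   finite near q; this does not change the interior. *)
Definition Jset : set R :=
  [set q : R | [/\ \forall p \near q, ttau p \is a fin_num,
                   derivable (fine \o ttau) q 1 &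
                   0 < derive1 (fine \o ttau) q * q - fine (ttau q)]]°.

End structure_function.

(* At a null interval and q < 0 the library's power is 0 instead of +oo; the
   measures considered here almost surely charge every b-adic interval. *)
Definition tau_n (R : realType) (b : nat)
    (m : {finite_measure set (measurableTypeR R) -> \bar R})
    (n : nat) (q : R) : \bar R :=
  (- ((n%:R^-1)%:E *
      logb b (\sum_(v : n.-tuple 'I_b) poweR (m (@word_interval R b v)) q)))%E.

(* Main.v *)
(* With V_q = W^q / E(sum_k W_k^q), the recursion of the cascade gives
   b^(n ttau(q)) sum_v mu^w(I_v)^q = sum_v V_q(w, v) (Y_1^{wv})^q and
   Y_q^w = sum_v V_q(w, v) Y_q^{wv}, the sums running over the words v of
   length n and V_q(w, v) being the product of the weights along v.  Hence both
   estimates follow from the uniform bound |log Y_q^u| <= theta log |u| for all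
   long words u and all q in a compact set.

   For the latter, J = R forces ttau(2q) > 2 ttau(q) for all q, whence
   V_q <= r < 1 almost surely, uniformly on compact sets.  Replace the weights
   of the first m ~ 2 log_2 j generations below u, |u| = j, by b^-1: this
   changes the logarithm of the total weight by O(m) = O(log j) only.  The
   modified total weight is a martingale starting from 1 whose increment at
   generation m + n is a sum of independent centred terms of size at most
   b^-m r^n <= j^-2 r^n.  A Chernoff bound along a grid of q refined
   geometrically with n, together with the Lipschitz dependence on q, keeps it
   between e^-1 and e for all n and q, outside an event whose probability is
   summable over all words u. *)

(* The recursion quoted above rests on the exact identity mu^w(I_v) = V_1(w, v) Y_1^{wv}, and weak
   convergence alone does not give it: mass might concentrate at the end points of b-adic intervals.
   This is excluded because the expected mass of a cell that touches an end point, [p] generations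
   further down, is at most r^p times a power of the length of its word. The logarithmic bound
   therefore comes first, for limits of total weights alone, and the identity is deduced from it.

   In the tail estimate the squares of the coefficients are at most b^-m r^n times the coefficients,
   so the variance of an increment is controlled by b^-m r^n times the current modified weight. Each
   tail is therefore taken on the event that this weight is at most 8, and the induction over the
   generations keeps it there. The increment allowed is [e0] rho^n with r <= rho^4, which makes the
   Gaussian exponent at least a constant times j^2 + n^2: the first square beats the b^j words, the
   second the grid, which has of the order of 4^n points. *)
Require Import Defs.
From HB Require Import structures.
From mathcomp Require Import all_boot all_order all_algebra.
From mathcomp Require Import all_classical all_reals all_analysis.
From mathcomp Require Import measurable_realfun ring lra zify.
Import Order.TTheory GRing.Theory Num.Theory.
Import numFieldNormedType.Exports.
Local Open Scope classical_set_scope.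
Local Open Scope ring_scope.

Set Implicit Arguments.
Unset Strict Implicit.
Unset Printing Implicit Defensive.

(** * Independence and exponential martingales *)

Section independence.
Context (d d' : measure_display) (T : measurableType d) (E : measurableType d')
  (R : realType) (P : probability T R) (I : eqType) (X : I -> {mfun T >-> E}).
Hypothesis Xindep : mutually_independent P X.

(* The pi-system generating the sigma-algebra of all X u with u <> v. *)
Definition cylinders_avoiding (v : I) : set (set T) :=
  [set C | exists (s : seq I) (B : I -> set E),
    [/\ uniq s, v \notin s, forall i, measurable (B i) &
        C = [set x | forall i, i \in s -> B i (X i x)]]].

Lemma cylinders_avoiding_measurable v C :
  cylinders_avoiding v C -> measurable C.
Proof.
move=> [s [B [_ _ mB ->]]].
rewrite [X in measurable X](_ : _ =
    \bigcap_(i in [set` s]) (X i @^-1` B i)); last first.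
  by apply/seteqP; split=> x /= Hx i /Hx.
apply: fin_bigcap_measurable => [|i _]; first exact: finite_seq.
by rewrite -[X in measurable X]setTI; exact: measurable_funP.
Qed.

Lemma cylinders_avoiding_setI v : setI_closed (cylinders_avoiding v).
Proof.
move=> _ _ [s1 [B1 [u1 vs1 mB1 ->]]] [s2 [B2 [u2 vs2 mB2 ->]]].
exists (undup (s1 ++ s2)), (fun i =>
  (if i \in s1 then B1 i else setT) `&` (if i \in s2 then B2 i else setT)).
split => [||i|]; first exact: undup_uniq.
- by rewrite mem_undup mem_cat negb_or vs1.
- by apply: measurableI; case: ifP.
- apply/seteqP; split => x /=.
    move=> [H1 H2] i _; split.
      by case: ifPn => // /H1.
    by case: ifPn => // /H2.
  move=> Hx; split => i si.
    have /Hx[+ _] : i \in undup (s1 ++ s2) by rewrite mem_undup mem_cat si.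
    by rewrite si.
  have /Hx[_ +] : i \in undup (s1 ++ s2) by rewrite mem_undup mem_cat si orbT.
  by rewrite si.
Qed.

(** For fixed [B], both sides are finite measures in [C]. They agree on the pi-system by the product
    rule for [v :: s], hence on the sigma-algebra that it generates. *)
Lemma indep_cylinders_avoiding v (B : set E) (C : set T) : measurable B ->
  <<s cylinders_avoiding v >> C ->
  P (C `&` X v @^-1` B) = (P C * P (X v @^-1` B))%E.
Proof.
move=> mB sC.
have mXB : measurable (X v @^-1` B).
  by rewrite -[X in measurable X]setTI; exact: measurable_funP.
have p0 : 0 <= fine (P (X v @^-1` B)) by exact: fine_ge0.
pose m1 := mrestr P mXB.
pose m2 := mscale (NngNum p0) P.
have m2E A : m2 A = (P A * P (X v @^-1` B))%E.
  by rewrite /m2 /mscale/= muleC fineK// fin_num_measure.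
have HE : [set X | cylinders_avoiding v X /\ X `<=` setT] =
    cylinders_avoiding v.
  by apply/seteqP; split => [A []|A].
rewrite -m2E -[LHS]/(m1 C).
apply: (@g_sigma_algebra_measure_unique_trace _ _ _
  (cylinders_avoiding v) setT measurableT _ _ m1 m2).
- by rewrite HE => A; exact: cylinders_avoiding_measurable.
- by rewrite HE; exact: cylinders_avoiding_setI.
- rewrite [RHS](m2E setT) [LHS]/(P _) setTI probability_setT mul1e.
  by [].
- rewrite HE => A -[s [D [us vs mD AE]]].
  rewrite [RHS](m2E A) [LHS]/(P _) AE.
  rewrite (Xindep us mD).
  have := @Xindep (v :: s) (fun i => if i == v then B else D i).
  rewrite big_cons eqxx /= vs us => /(_ isT) H.
  rewrite muleC.
  under eq_big_seq => i si.
    have iv : i != v by apply: contraNneq vs => <-.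
    rewrite (_ : D i = if i == v then B else D i); last by rewrite (negbTE iv).
    over.
  rewrite -H; last by move=> i; case: ifP.
  congr (P _); apply/seteqP; split => x /=.
    move=> [H1 H2] i; rewrite inE => /predU1P[->|si]; first by rewrite eqxx.
    by have /negbTE -> : i != v; [apply: contraNneq vs => <-|exact: H1].
  move=> Hx; split.
    move=> i si; have := Hx i; rewrite inE si orbT => /(_ isT).
    by have /negbTE -> : i != v by apply: contraNneq vs => <-.
  by have := Hx v; rewrite mem_head eqxx; exact.
- apply: (@le_lt_trans _ _ 1%E); last exact: ltry.
  by apply: (probability_le1 P); exact: measurableI.
- by move=> A _.
- by rewrite HE.
Qed.

Lemma sigma_avoiding_sub v : <<s cylinders_avoiding v >> `<=` @measurable _ T.
Proof.
apply: smallest_sub; first exact: sigma_algebra_measurable.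
exact: cylinders_avoiding_measurable.
Qed.

Lemma measurable_avoiding v u : u != v ->
  measurable_fun setT (X u : g_sigma_algebraType (cylinders_avoiding v) -> E).
Proof.
move=> uv _ A mA; rewrite setTI; apply: sub_sigma_algebra.
exists [:: u], (fun=> A); split => //; first by rewrite inE eq_sym.
apply/seteqP; split => x /=; last by apply; rewrite inE.
by move=> Ax i; rewrite inE => /eqP ->.
Qed.

(** As [f] depends only on the [X u] with [u] other than [v], the joint law of [f] and [X v] is the
    product of their laws, and Tonelli's theorem applies. *)
Lemma indep_tonelli v d1 (T1 : measurableType d1) (f : T -> T1)
    (F : T1 * E -> \bar R) :
  (forall A, measurable A -> <<s cylinders_avoiding v >> (f @^-1` A)) ->
  measurable_fun setT F -> (forall z, (0 <= F z)%E) ->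
  (\int[P]_x F (f x, X v x) =
   \int[P]_x \int[distribution P (X v)]_y F (f x, y))%E.
Proof.
move=> Gf mF F0.
have mf : measurable_fun setT f.
  by move=> _ A mA; rewrite setTI; apply: sigma_avoiding_sub; exact: Gf.
have mfX : measurable_fun setT (fun x => (f x, X v x)).
  by apply/measurable_fun_pairP; split => //=; exact: measurable_funP.
pose fT : {mfun T >-> T1} := mfun_Sub (mem_set mf).
pose fXT : {mfun T >-> (T1 * E)%type} := mfun_Sub (mem_set mfX).
pose m1 := distribution P fT.
pose m2 := distribution P (X v).
transitivity (\int[distribution P fXT]_z F z)%E.
  by rewrite ge0_integral_distribution.
transitivity (\int[(m1 \x m2)%E]_z F z)%E.
  apply: eq_measure_integral => A mA _; apply/esym.
  apply: product_measure_unique => // C B mC mB.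
  by have := @indep_cylinders_avoiding v B (f @^-1` C) mB (Gf _ mC).
rewrite fubini_tonelli1//.
rewrite ge0_integral_distribution// => [|x]; last exact: integral_ge0.
exact: measurable_fun_fubini_tonelli_F.
Qed.

End independence.

Lemma measurable_sum_in (d : measure_display) (T : measurableType d)
    (R : realType) (I : eqType) (s : seq I) (h : I -> T -> R) :
  (forall i, i \in s -> measurable_fun setT (h i)) ->
  measurable_fun setT (fun x => \sum_(i <- s) h i x).
Proof.
move=> mh; under eq_fun do rewrite big_seq big_mkcond.
apply: measurable_sum => i.
by have [/mh|] := boolP (i \in s); [|move=> _; exact: measurable_cst].
Qed.

(** Compare both sides with 1 / (1 - x), which dominates the exponential because exp(-x) >= 1 -
    x. *)
Lemma expR_le1DxDsqr (R : realType) (x : R) :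
  x <= 2^-1 -> expR x <= 1 + x + 2 * x ^+ 2.
Proof.
move=> x2.
have h : 1 <= (1 + x + 2 * x ^+ 2) * (1 - x).
  have -> : (1 + x + 2 * x ^+ 2) * (1 - x) = 1 + x ^+ 2 * (1 - 2 * x) by ring.
  by rewrite lerDl mulr_ge0 ?sqr_ge0//; lra.
have x1 : 0 < 1 - x by lra.
apply: (@le_trans _ _ (1 - x)^-1).
  rewrite -[expR x]invrK lef_pV2 ?posrE ?invr_gt0 ?expR_gt0//.
  by rewrite -expRN; apply: le_trans (expR_ge1Dx _).
by rewrite -div1r ler_pdivrMr.
Qed.

(** Integrate the quadratic bound of [expR_le1DxDsqr]: centring removes the linear term, and 1 + 2
    (c B)^2 is at most the exponential on the right. *)
Lemma mgf_bounded_centered (d : measure_display) (E : measurableType d)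
    (R : realType) (Q : probability E R) (xi : E -> R) (B c : R) :
  measurable_fun setT xi -> (forall y, `|xi y| <= B) ->
  (\int[Q]_y (xi y)%:E = 0)%E -> `|c| * B <= 2^-1 ->
  (\int[Q]_y (expR (c * xi y))%:E <= (expR (2 * (c * B) ^+ 2))%:E)%E.
Proof.
move=> mxi xiB xi0 cB.
have mcxi : measurable_fun setT (fun y => c * xi y).
  exact: measurable_funM.
have ixi : Q.-integrable setT (EFin \o xi).
  apply: measurable_bounded_integrable => //.
    by rewrite [X in (X < _)%E]probability_setT ltry.
  exists B; split; first exact: num_real.
  by move=> M BM x _; exact: le_trans (xiB x) (ltW BM).
have icxi : Q.-integrable setT (fun y => (c%:E * (xi y)%:E)%E).
  exact: integrableZl.
pose k : R := 1 + 2 * (c * B) ^+ 2.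
have ik : Q.-integrable setT (cst k%:E).
  by apply: finite_measure_integrable_cst.
apply: (@le_trans _ _ (\int[Q]_y (cst k%:E \+ (fun y => (c%:E * (xi y)%:E)%E)) y)%E).
  apply: ge0_le_integral => //=.
  - by apply/measurable_EFinP; apply: measurableT_comp.
  - by apply: emeasurable_funD => //; apply/measurable_EFinP.
  - move=> y _; rewrite -EFinM -EFinD lee_fin.
    have cxi : `|c * xi y| <= 2^-1.
      by rewrite normrM (le_trans _ cB)// ler_wpM2l.
    apply: (le_trans (expR_le1DxDsqr _)).
      exact: le_trans (ler_norm _) cxi.
    rewrite /k -addrA -(addrA _ _ (c * xi y)) lerD2l addrC lerD2r.
    rewrite ler_pM2l ?ltr0n// -[leLHS]real_normK ?num_real//.
    rewrite -[leRHS]real_normK ?num_real// lerXn2r ?nnegrE//.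
    rewrite !normrM ler_wpM2l// (le_trans (xiB y))// ler_norm//.
rewrite integralD// integral_cst// [X in (_ * X)%E]probability_setT mule1.
rewrite integralZl// xi0 mule0 adde0 lee_fin.
exact: expR_ge1Dx.
Qed.

Section exponential_martingale.
Context (d d' : measure_display) (T : measurableType d) (E : measurableType d')
  (R : realType) (P : probability T R) (I : eqType) (X : I -> {mfun T >-> E}).
Hypothesis Xindep : mutually_independent P X.
Variables (xi : E -> R) (B eta : R) (a : I -> T -> R).
Hypotheses (mxi : measurable_fun setT xi) (xiB : forall y, `|xi y| <= B).
Hypothesis xi0 : forall v, (\int[distribution P (X v)]_y (xi y)%:E = 0)%E.
Hypothesis a0 : forall v x, 0 <= a v x <= eta.

Definition avoiding_measurable (s : seq I) := forall u v, u \in s -> v \in s ->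
  measurable_fun setT (a u : g_sigma_algebraType (cylinders_avoiding X v) -> R).

(* The weight a v of each v in s does not depend on X u for any u in s, so the
   words can be integrated out one at a time, in any order. *)
Lemma exp_martingale (s : seq I) (l : R) : uniq s -> avoiding_measurable s ->
  `|l| * eta * B <= 2^-1 ->
  (\int[P]_x (expR (\sum_(v <- s)
     (l * a v x * xi (X v x) - 2 * (l * a v x * B) ^+ 2)))%:E <= 1)%E.
Proof.
move=> + + lB; elim: s => [_ _|v s IHs /= /andP[vs us] ma].
  under eq_integral do rewrite big_nil expR0.
  by rewrite integral_cst// [X in (_ * X)%E]probability_setT mule1.
have {}IHs : _ := IHs us (fun u w us' ws => ma u w (mem_behead (s := v :: s) us')
  (mem_behead (s := v :: s) ws)).
apply: le_trans IHs.
(* The word [v] is integrated out: [f] gathers what depends on the other words only, and [X v]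
   enters through the last coordinate of [F] alone. *)
pose F (z : (R * R) * E) :=
  (expR (z.1.1 - 2 * (l * z.1.2 * B) ^+ 2 + l * z.1.2 * xi z.2))%:E.
pose f x := (\sum_(u <- s) (l * a u x * xi (X u x) - 2 * (l * a u x * B) ^+ 2), a v x).
have mF : measurable_fun setT F.
  apply/measurable_EFinP; apply: measurableT_comp => //.
  have m11 : measurable_fun setT (fun z : (R * R) * E => z.1.1).
    exact: (measurableT_comp measurable_fst).
  have m12 : measurable_fun setT (fun z : (R * R) * E => z.1.2).
    exact: (measurableT_comp measurable_snd).
  have lz : measurable_fun setT (fun z : (R * R) * E => l * z.1.2).
    exact: measurable_funM.
  apply: measurable_funD; last first.
    apply: measurable_funM => //.
    exact: (measurableT_comp mxi).
  apply: measurable_funB => //.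
  apply: measurable_funM => //.
  by apply: measurable_funX; apply: measurable_funM.
have Gf A : measurable A -> <<s cylinders_avoiding X v >> (f @^-1` A).
  move=> mA.
  suff /(_ measurableT A mA) : measurable_fun setT
    (f : g_sigma_algebraType (cylinders_avoiding X v) -> R * R).
    by rewrite setTI.
  apply/measurable_fun_pairP; split => /=; last by apply: ma; rewrite mem_head.
  apply: measurable_sum_in => u us'.
  have uv : u != v by apply: contraNneq vs => <-.
  have mau : measurable_fun setT
      (a u : g_sigma_algebraType (cylinders_avoiding X v) -> R).
    by apply: ma; rewrite !inE ?us' ?eqxx ?orbT.
  have mXu : measurable_fun setT
    (X u : g_sigma_algebraType (cylinders_avoiding X v) -> E).
    exact: measurable_avoiding.
  apply: measurable_funB; apply: measurable_funM => //.
  - exact: measurable_funM.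
  - exact: (measurableT_comp mxi).
  - by apply: measurable_funX; apply: measurable_funM => //; apply: measurable_funM.
have F0 z : (0 <= F z)%E by rewrite lee_fin expR_ge0.
have := indep_tonelli Xindep Gf mF F0.
rewrite (_ : (fun x => F (f x, X v x)) = (fun x => (expR (\sum_(v0 <- v :: s)
    (l * a v0 x * xi (X v0 x) - 2 * (l * a v0 x * B) ^+ 2)))%:E)); last first.
  apply/funext => x; rewrite /F /f/= big_cons; congr (expR _)%:E.
  by rewrite addrC addrA addrAC addrC !addrA.
move=> ->.
have mf : measurable_fun setT f.
  move=> _ A mA; rewrite setTI.
  by apply: (@sigma_avoiding_sub _ _ _ _ _ X v); exact: Gf.
have mf1 : measurable_fun setT (fun x => (f x).1).
  exact: (measurableT_comp measurable_fst).
have mFX x : measurable_fun setT (fun y => F (f x, y)).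
  by apply: (measurableT_comp mF); exact: measurable_pair1.
apply: ge0_le_integral => //.
- by move=> x _; apply: integral_ge0.
- have := measurable_fun_fubini_tonelli_F (m2 := distribution P (X v)) F mF F0.
  by move=> mFF; exact: (measurableT_comp mFF mf).
- by apply/measurable_EFinP; apply: (measurableT_comp _ mf1).
- move=> x _.
  have -> : (\int[distribution P (X v)]_y F (f x, y))%E =
    ((expR ((f x).1 - 2 * (l * a v x * B) ^+ 2))%:E *
    \int[distribution P (X v)]_y (expR (l * a v x * xi y))%:E)%E.
    rewrite -ge0_integralZl_EFin ?expR_ge0//.
    + by apply: eq_integral => y _; rewrite /F/= expRD EFinM.
    + apply/measurable_EFinP; apply: measurableT_comp => //.
      exact: measurable_funM.
  rewrite expRB EFinM -muleA -[leRHS]mule1.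
  rewrite lee_pmul2l ?lte_fin ?expR_gt0//.
  rewrite muleC lee_pdivrMr ?expR_gt0// mul1e.
  apply: mgf_bounded_centered => //; first exact: xi0.
  rewrite normrM (le_trans _ lB)//.
  have B0 : 0 <= B by apply: le_trans (xiB point).
  rewrite ler_wpM2r// ler_wpM2l//.
  by have /andP[? ?] := a0 v x; rewrite ger0_norm.
Qed.

(** Chernoff's bound. Where the [a v] add up to at most [M], their squares add up to at most
    [eta * M], so the exponent is at least l e - 2 l^2 B^2 eta M; the [l] chosen below maximizes it.
    The condition on [e] is what keeps l eta B <= 1/2. *)
Lemma martingale_step_tail (s : seq I) (e M : R) : uniq s ->
  avoiding_measurable s -> (forall v, v \in s -> measurable_fun setT (a v)) ->
  0 < B -> 0 < eta -> 0 < e -> 0 < M -> e <= 2 * B * M ->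
  (P [set x | e <= `|\sum_(v <- s) a v x * xi (X v x)|
     /\ \sum_(v <- s) a v x <= M]%R
   <= (2 * expR (- (e ^+ 2 / (8 * B ^+ 2 * eta * M))))%:E)%E.
Proof.
move=> us ma maT B0 eta0 e0 M0 eBM.
pose l := e / (4 * B ^+ 2 * eta * M).
have l0 : 0 < l by rewrite divr_gt0// !mulr_gt0// exprn_gt0.
have lB : l * eta * B <= 2^-1.
  have -> : l * eta * B = e / (4 * B * M).
    by rewrite /l; field; rewrite !lt0r_neq0.
  rewrite ler_pdivrMr ?mulr_gt0//.
  by apply: le_trans eBM _; lra.
have mS : measurable_fun setT (fun x => \sum_(v <- s) a v x * xi (X v x)).
  apply: measurable_sum_in => v vs; apply: measurable_funM; first exact: maT.
  exact: (measurableT_comp mxi).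
have mA : measurable_fun setT (fun x => \sum_(v <- s) a v x).
  exact: measurable_sum_in.
have mset (k : R) (g : T -> R) : measurable_fun setT g ->
    measurable [set x | k <= g x /\ \sum_(v <- s) a v x <= M].
  move=> mg; apply: measurableI;
    by rewrite -[X in measurable X]setTI; exact: measurable_fun_le.
(* Used for [k = l] and for [k = - l], one for each sign of the sum. *)
have half (k : R) : `|k| = l ->
  (P [set x | l * e <= k * \sum_(v <- s) a v x * xi (X v x)
     /\ \sum_(v <- s) a v x <= M]%R
   <= (expR (- (e ^+ 2 / (8 * B ^+ 2 * eta * M))))%:E)%E.
  move=> kl.
  pose Z x := \sum_(v <- s) (k * a v x * xi (X v x) - 2 * (k * a v x * B) ^+ 2).
  have mZ : measurable_fun setT Z.
    apply: measurable_sum_in => v vs; apply: measurable_funB.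
      apply: measurable_funM; last exact: (measurableT_comp mxi).
      by apply: measurable_funM => //; exact: maT.
    apply: measurable_funM => //; apply: measurable_funX.
    by apply: measurable_funM => //; apply: measurable_funM => //; exact: maT.
  have Z1 : (\int[P]_x (expR (Z x))%:E <= 1)%E.
    by apply: exp_martingale => //; rewrite kl.
  pose c := e ^+ 2 / (8 * B ^+ 2 * eta * M).
  have sub : [set x | l * e <= k * \sum_(v <- s) a v x * xi (X v x)
     /\ \sum_(v <- s) a v x <= M] `<=` [set x | c <= Z x].
    move=> x /= [h1 h2]; rewrite /Z sumrB.
    have -> : \sum_(v <- s) k * a v x * xi (X v x) =
        k * \sum_(v <- s) a v x * xi (X v x).
      by rewrite mulr_sumr; apply: eq_bigr => v _; rewrite mulrA.
    have h3 : \sum_(v <- s) 2 * (k * a v x * B) ^+ 2 <=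
        2 * (l * B) ^+ 2 * eta * M.
      apply: (@le_trans _ _ (\sum_(v <- s) 2 * (l * B) ^+ 2 * eta * a v x)).
        apply: ler_sum => v _; have /andP[a1 a2] := a0 v x.
        have -> : 2 * (k * a v x * B) ^+ 2 = 2 * (k ^+ 2) * B ^+ 2 * (a v x * a v x).
          by ring.
        rewrite -[k ^+ 2]real_normK ?num_real// kl.
        have -> : 2 * (l * B) ^+ 2 * eta * a v x =
          2 * l ^+ 2 * B ^+ 2 * (eta * a v x) by ring.
        apply: ler_wpM2l; last by rewrite ler_wpM2r.
        by rewrite -mulrA -exprMn; apply: mulr_ge0 => //; exact: sqr_ge0.
      rewrite -mulr_sumr; apply: ler_wpM2l h2.
      apply: mulr_ge0; last exact: ltW.
      by apply: mulr_ge0 => //; exact: sqr_ge0.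
    have lce : l * e - 2 * (l * B) ^+ 2 * eta * M = c.
      by rewrite /l /c; field; rewrite !lt0r_neq0.
    by rewrite -lce lerB.
  apply: (@le_trans _ _ (P [set x | c <= Z x]%R)).
    apply: le_measure; rewrite ?inE//; last first.
      by rewrite -[X in measurable X]setTI; exact: measurable_fun_le.
    by apply: mset; exact: measurable_funM.
  pose ZT : {RV P >-> R} := mfun_Sub (mem_set mZ).
  have := @chernoff _ _ _ P ZT 1 c ltr01.
  move=> /le_trans; apply; rewrite mul1r -[leRHS]mul1e.
  rewrite lee_pmul2r ?lte_fin ?expR_gt0//.
  rewrite /mmt_gen_fun expectation_def/=.
  apply: le_trans Z1; apply: ge0_le_integral => //=.
  - by apply/measurable_EFinP; apply: measurableT_comp => //; exact: measurable_funM.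
  - by apply/measurable_EFinP; apply: measurableT_comp.
  - by move=> x _; rewrite mulr1.
set p := expR _.
have -> : (2 * p)%:E = (p%:E + p%:E)%E by rewrite -EFinD; congr EFin; ring.
have hp := half l (gtr0_norm l0).
have hm := half (- l); rewrite normrN gtr0_norm// in hm.
have {}hm := hm erefl.
apply: le_trans (leeD hp hm).
apply: le_trans (measureU2 _ _ _); rewrite /=.
- apply: le_measure; rewrite ?inE//.
  + by apply: mset; exact: measurableT_comp.
  + by apply: measurableU; apply: mset; exact: measurable_funM.
  + move=> x /= [ex Mx].
    have [S0|S0] := leP 0 (\sum_(v <- s) a v x * xi (X v x)).
      by left; split => //; rewrite ler_pM2l//; rewrite ger0_norm in ex.
    right; split => //; rewrite mulNr -mulrN ler_pM2l//.
    by rewrite ltr0_norm in ex.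
- by apply: mset; exact: measurable_funM.
- by apply: mset; exact: measurable_funM.
Qed.

End exponential_martingale.

(** * Weights of words *)

Section word_weights.
Context (R : realType) (b : nat).
Implicit Types (V : seq 'I_b -> 'I_b -> R) (u v w : seq 'I_b) (i : 'I_b).

Fixpoint wt V w v : R :=
  if v is i :: v' then V w i * wt V (rcons w i) v' else 1.

Lemma wt_cat V w u v : wt V w (u ++ v) = wt V w u * wt V (w ++ u) v.
Proof.
elim: u w => [|i u IHu] w /=; first by rewrite cats0 mul1r.
by rewrite IHu mulrA cat_rcons.
Qed.

Lemma wt_rcons V w v i : wt V w (rcons v i) = wt V w v * V (w ++ v) i.
Proof. by rewrite -cats1 wt_cat /= mulr1. Qed.

Lemma eq_wt V V' w v : (forall u i, V u i = V' u i) -> wt V w v = wt V' w v.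
Proof. by move=> VV'; elim: v w => //= i v IHv w; rewrite VV' IHv. Qed.

Lemma wt_bounds V (c C : R) w v : 0 <= c ->
  (forall u i, c <= V u i <= C) -> c ^+ size v <= wt V w v <= C ^+ size v.
Proof.
move=> c0 VC; elim: v w => [|i v IHv] w /=; first by rewrite lexx.
have /andP[h1 h2] := VC w i; have /andP[h3 h4] := IHv (rcons w i).
rewrite !exprS; apply/andP; split; apply: ler_pM => //.
- exact: exprn_ge0.
- exact: le_trans h1.
- exact: le_trans (exprn_ge0 _ c0) h3.
Qed.

Lemma wt_gt0 V w v : (forall u i, 0 < V u i) -> 0 < wt V w v.
Proof. by move=> V0; elim: v w => //= i v IHv w; rewrite mulr_gt0. Qed.

Lemma sum_0tuple (F : seq 'I_b -> R) : \sum_(v : 0.-tuple 'I_b) F v = F [::].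
Proof.
rewrite (big_pred1 [tuple]) // => v.
by apply/esym/eqP; rewrite [v]tuple0; exact: val_inj.
Qed.

Lemma sum_tupleS n (F : seq 'I_b -> R) :
  \sum_(v : n.+1.-tuple 'I_b) F v =
  \sum_(i < b) \sum_(v : n.-tuple 'I_b) F (i :: v).
Proof.
rewrite pair_big /=.
rewrite (reindex (fun p : 'I_b * n.-tuple 'I_b => [tuple of p.1 :: p.2])) //=.
exists (fun v : n.+1.-tuple 'I_b => (thead v, [tuple of behead v])).
- by move=> [i v] _; congr pair; apply/val_inj.
- by move=> v _; rewrite -tuple_eta.
Qed.

Lemma sum_tuple_cat m n (F : seq 'I_b -> R) :
  \sum_(v : (m + n).-tuple 'I_b) F v =
  \sum_(u : m.-tuple 'I_b) \sum_(v : n.-tuple 'I_b) F (u ++ v).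
Proof.
elim: m F => [|m IHm] F.
  by rewrite (sum_0tuple (fun u => \sum_(v : n.-tuple 'I_b) F (u ++ v))).
rewrite (sum_tupleS _ (fun u => \sum_(v : n.-tuple 'I_b) F (u ++ v))) addSn sum_tupleS.
by apply: eq_bigr => i _; rewrite (IHm (fun v => F (i :: v))).
Qed.

Lemma sum_1tuple (F : seq 'I_b -> R) :
  \sum_(v : 1.-tuple 'I_b) F v = \sum_(i < b) F [:: i].
Proof.
by rewrite sum_tupleS; apply: eq_bigr => i _; rewrite (sum_0tuple (fun v => F (i :: v))).
Qed.

Definition total_wt V n w : R := \sum_(v : n.-tuple 'I_b) wt V w v.

Lemma total_wt_cat V m n w : total_wt V (m + n) w =
  \sum_(u : m.-tuple 'I_b) wt V w u * total_wt V n (w ++ u).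
Proof.
rewrite /total_wt (sum_tuple_cat m n (wt V w)); apply: eq_bigr => u _.
by rewrite mulr_sumr; apply: eq_bigr => v _; rewrite wt_cat.
Qed.

Lemma total_wt0 V w : total_wt V 0 w = 1.
Proof. by rewrite /total_wt (sum_0tuple (wt V w)). Qed.

Lemma total_wt1 V w : total_wt V 1 w = \sum_(i < b) V w i.
Proof.
by rewrite /total_wt (sum_1tuple (wt V w)); apply: eq_bigr => i _ /=; rewrite mulr1.
Qed.

Lemma total_wt_gt0 V n w : (0 < b)%N -> (forall u i, 0 < V u i) ->
  0 < total_wt V n w.
Proof.
move=> b0 V0; have wt0 v : 0 <= wt V w v by exact/ltW/wt_gt0.
rewrite lt0r sumr_ge0// andbT psumr_neq0//; apply/hasP.
by exists [tuple of nseq n (Ordinal b0)]; rewrite ?mem_index_enum//= wt_gt0.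
Qed.

(* The total weight below w when the first m generations carry the uniform
   weight b^-m in place of V: it starts from 1, and each word of generation
   m + n has weight at most b^-m (sup V)^n. *)
Definition flat_wt V m n w : R :=
  b%:R ^- m * \sum_(u : m.-tuple 'I_b) total_wt V n (w ++ u).

End word_weights.

Lemma measurable_wt (d : measure_display) (T : measurableType d) (R : realType)
    (b : nat) (V : T -> seq 'I_b -> 'I_b -> R) (L : nat) (w v : seq 'I_b) :
  (forall u i, (size u < L)%N -> measurable_fun setT (fun x => V x u i)) ->
  (size w + size v <= L)%N -> measurable_fun setT (fun x => wt (V x) w v).
Proof.
move=> mV; elim: v w => [|i v IHv] w /= wL; first exact: measurable_cst.
apply: measurable_funM.
  by apply: mV; rewrite (leq_trans _ wL)// addnS ltnS leq_addr.
by apply: IHv; rewrite size_rcons addSnnS.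
Qed.

Section flat_increments.
Context (R : realType) (b : nat) (V : seq 'I_b -> 'I_b -> R) (m : nat).
Variable w : seq 'I_b.

Definition flat_words n : seq (seq 'I_b) :=
  [seq w ++ val v | v : (m + n).-tuple 'I_b].

(** A function of the whole word, cut by position into its flat and its weighted part, because
    [martingale_step_tail] attaches a coefficient to each index of the family of weights. *)
Definition flat_coef (z : seq 'I_b) : R :=
  b%:R ^- m * wt V (take (size w + m) z) (drop (size w + m) z).

Lemma flat_words_uniq n : uniq (flat_words n).
Proof.
rewrite map_inj_uniq ?enum_uniq// => u v /eqP.
by rewrite eqseq_cat// eqxx /= => /eqP /val_inj.
Qed.

Lemma size_flat_words n z : z \in flat_words n -> size z = (size w + (m + n))%N.
Proof. by move=> /mapP[v _ ->]; rewrite size_cat size_tuple. Qed.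

Lemma sum_flat_words n (F : seq 'I_b -> R) :
  \sum_(z <- flat_words n) F z =
  \sum_(u : m.-tuple 'I_b) \sum_(v : n.-tuple 'I_b) F (w ++ u ++ v).
Proof.
rewrite /flat_words big_map big_enum /=.
exact: (sum_tuple_cat m n (fun v => F (w ++ v))).
Qed.

Lemma flat_coefE (u : m.-tuple 'I_b) (v : seq 'I_b) :
  flat_coef (w ++ u ++ v) = b%:R ^- m * wt V (w ++ u) v.
Proof.
have sz : (size w + m = size (w ++ u))%N by rewrite size_cat size_tuple.
by rewrite /flat_coef catA sz take_size_cat// drop_size_cat.
Qed.

Lemma flat_wtE n : flat_wt V m n w = \sum_(z <- flat_words n) flat_coef z.
Proof.
rewrite sum_flat_words /flat_wt mulr_sumr; apply: eq_bigr => u _.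
by rewrite mulr_sumr; apply: eq_bigr => v _; rewrite flat_coefE.
Qed.

(** The form of a martingale difference: the coefficient of [z] involves only the weights at words
    shorter than [z], the last factor only those at [z]. *)
Lemma flat_wt_increment n : flat_wt V m n.+1 w - flat_wt V m n w =
  \sum_(z <- flat_words n) flat_coef z * (\sum_(i < b) V z i - 1).
Proof.
rewrite sum_flat_words /flat_wt -mulrBr -sumrB mulr_sumr.
apply: eq_bigr => u _; rewrite -addn1 total_wt_cat -sumrB mulr_sumr.
apply: eq_bigr => v _; rewrite flat_coefE total_wt1 catA.
by rewrite -mulrA; congr (_ * _); ring.
Qed.

Lemma flat_wt0 : (0 < b)%N -> flat_wt V m 0 w = 1.
Proof.
move=> b0; rewrite /flat_wt.
under eq_bigr do rewrite total_wt0.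
rewrite sumr_const card_tuple card_ord -natrX mulVf//.
by rewrite pnatr_eq0 expn_eq0 negb_and -lt0n b0.
Qed.

End flat_increments.

Section step_probability.
Context (d d' : measure_display) (T : measurableType d) (E : measurableType d')
  (R : realType) (P : probability T R) (b : nat)
  (W : seq 'I_b -> {mfun T >-> E}).
Hypothesis Windep : mutually_independent P W.
Variables (f : 'I_b -> E -> R) (r : R).
Hypotheses (b0 : (0 < b)%N) (r01 : 0 < r <= 1).
Hypotheses (mf : forall i, measurable_fun setT (f i))
  (fr : forall i y, 0 <= f i y <= r).
Hypothesis f1 : forall u,
  (\int[distribution P (W u)]_y (\sum_(i < b) f i y)%:E = 1)%E.

Let V x u i := f i (W u x).

Lemma measurable_flat_wt m n w : measurable_fun setT (fun x => flat_wt (V x) m n w).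
Proof.
apply: measurable_funM => //.
apply: measurable_sum => u; apply: measurable_sum => v.
apply: (@measurable_wt _ _ _ _ _ (size (w ++ u) + size v)) => // z i _.
exact: (measurableT_comp (mf i)).
Qed.

(** An instance of [martingale_step_tail] with B = b, eta = b^-m r^n and M = 8, so that 16 b is 2 B
    M. The words concerned all have the same length, hence no coefficient depends on the weights at
    any of them. *)
Lemma flat_step_tail m n w (e : R) : 0 < e <= 16 * b%:R ->
  (P [set x | e <= `|flat_wt (V x) m n.+1 w - flat_wt (V x) m n w|
     /\ flat_wt (V x) m n w <= 8]%R
   <= (2 * expR (- (e ^+ 2 / (64 * b%:R ^+ 2 * (b%:R ^- m * r ^+ n)))))%:E)%E.
Proof.
move=> /andP[e0 eb]; have /andP[r0 r1] := r01.
have bR0 : 0 < b%:R :> R by rewrite ltr0n.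
pose xi y := \sum_(i < b) f i y - 1.
pose s := flat_words m w n.
(* Set to 0 at all other lengths, since the bound by b^-m r^n is required at every index and
   [flat_coef] satisfies it only at this length. *)
pose a z x := if size z == (size w + (m + n))%N then flat_coef (V x) m w z else 0.
have mxi : measurable_fun setT xi.
  by apply: measurable_funB => //; apply: measurable_sum.
have sumf y : 0 <= \sum_(i < b) f i y <= b%:R.
  rewrite sumr_ge0 => [|i _]; last by have /andP[] := fr i y.
  rewrite -[leRHS]mulr1 mulr_natl -[X in _ *+ X]card_ord -sumr_const.
  by apply: ler_sum => i _; have /andP[_] := fr i y => /le_trans; apply.
have xib y : `|xi y| <= b%:R.
  have /andP[h1 h2] := sumf y.
  have b1 : 1 <= b%:R :> R by rewrite ler1n.
  by rewrite /xi ler_norml; apply/andP; split; lra.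
have xi0 u : (\int[distribution P (W u)]_y (xi y)%:E = 0)%E.
  have ifs : (distribution P (W u)).-integrable setT
      (EFin \o (fun y => \sum_(i < b) f i y)).
    apply: measurable_bounded_integrable => //.
    - by rewrite [X in (X < _)%E]probability_setT ltry.
    - exact: measurable_sum.
    - exists b%:R; split; first exact: num_real.
      move=> M bM y _; have /andP[h1 h2] := sumf y.
      by rewrite /= ger0_norm// (le_trans h2)// ltW.
  pose S y := \sum_(i < b) f i y.
  have -> : (fun y => (xi y)%:E) = ((EFin \o S) \- cst 1)%E.
    by apply/funext => y; rewrite /xi /= EFinB.
  rewrite integralB//; last exact: finite_measure_integrable_cst.
  rewrite [X in (X - _)%E]f1 integral_cst// mul1e.
  by rewrite [X in (_ - X)%E]probability_setT subee.
have eta0 : 0 < b%:R ^- m * r ^+ n by rewrite mulr_gt0// ?invr_gt0 exprn_gt0.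
have a0 z x : 0 <= a z x <= b%:R ^- m * r ^+ n.
  rewrite /a; case: ifP => [/eqP sz|_]; last by rewrite lexx ltW.
  rewrite /flat_coef; set p := take _ _; set q := drop _ _.
  have szq : size q = n by rewrite size_drop sz addnA addKn.
  have := @wt_bounds _ _ (V x) 0 r p q (lexx _) (fun u i => fr i (W u x)).
  rewrite szq => /andP[h1 h2].
  have h0 : 0 <= wt (V x) p q.
    by apply: le_trans h1; rewrite exprn_ge0.
  have hb : 0 <= b%:R ^- m :> R by rewrite invr_ge0 exprn_ge0.
  by rewrite mulr_ge0//= ler_wpM2l.
have aE z x : z \in s -> a z x = flat_coef (V x) m w z.
  by move=> /size_flat_words sz; rewrite /a sz eqxx.
have ma d1 (T1 : measurableType d1) (g : T1 -> T) z :
    (forall u, (size u < size w + (m + n))%N ->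
       measurable_fun setT (fun x : T1 => W u (g x))) ->
    measurable_fun setT (fun x : T1 => a z (g x)).
  move=> mW; rewrite /a; have [sz|_] := eqVneq (size z) (size w + (m + n))%N;
    last exact: measurable_cst.
  apply: measurable_funM => //.
  apply: (@measurable_wt _ _ _ _ _ (size w + (m + n))).
    by move=> u i us; apply: (measurableT_comp (mf i)); exact: mW.
  by rewrite -size_cat cat_take_drop sz.
have step x : \sum_(v <- s) a v x * xi (W v x) =
    flat_wt (V x) m n.+1 w - flat_wt (V x) m n w.
  rewrite flat_wt_increment; apply: eq_big_seq => z zs.
  by rewrite (aE _ _ zs).
have stepa x : \sum_(v <- s) a v x = flat_wt (V x) m n w.
  by rewrite flat_wtE; apply: eq_big_seq => z zs; rewrite (aE _ _ zs).
have := @martingale_step_tail _ _ _ _ _ P _ W Windep xi b%:R _ a mxi xib xi0 a0 s e 8.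
under eq_set do rewrite step stepa.
have -> : 8 * b%:R ^+ 2 * (b%:R ^- m * r ^+ n) * 8 =
    64 * b%:R ^+ 2 * (b%:R ^- m * r ^+ n) :> R by ring.
apply => //.
- exact: flat_words_uniq.
- move=> z z' zs z's.
  apply: (ma _ (g_sigma_algebraType (cylinders_avoiding W z')) idfun z) => u us.
  apply: measurable_avoiding; apply: contraTneq us => ->.
  by rewrite (size_flat_words z's) ltnn.
- by move=> z zs; apply: (ma _ _ idfun z).
- by apply: le_trans eb _; lra.
Qed.

End step_probability.

(** * Uniformity in the parameter *)

Lemma ler_lnB (R : realType) (x y : R) : 0 < x -> 0 < y ->
  ln x - ln y <= (x - y) / y.
Proof.
move=> x0 y0; rewrite -ln_div ?posrE//.
have -> : x / y = 1 + (x - y) / y by field; rewrite lt0r_neq0.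
apply: le_ln1Dx; rewrite ltr_pdivlMr//; lra.
Qed.

Lemma ler_norm_lnB (R : realType) (x y c : R) : 0 < c -> c <= x -> c <= y ->
  `|ln x - ln y| <= `|x - y| / c.
Proof.
move=> c0 cx cy; have x0 := lt_le_trans c0 cx; have y0 := lt_le_trans c0 cy.
have h u v : c <= u -> c <= v -> ln u - ln v <= `|u - v| / c.
  move=> cu cv; have u0 := lt_le_trans c0 cu; have v0 := lt_le_trans c0 cv.
  apply: le_trans (ler_lnB u0 v0) _.
  apply: (@le_trans _ _ (`|u - v| / v)).
    by rewrite ler_wpM2r ?invr_ge0 ?ler_norm// ltW.
  by rewrite ler_wpM2l// lef_pV2.
rewrite ler_norml h// andbT lerNl opprB distrC; exact: h.
Qed.

Lemma expR_3half_le8 (R : realType) : expR (3 / 2) <= 8 :> R.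
Proof.
have h : expR 2^-1 <= 2 :> R.
  by apply: le_trans (expR_le1DxDsqr (lexx _)) _; rewrite expr2; lra.
rewrite expRM_natl; apply: (@le_trans _ _ (2 ^+ 3)); last by rewrite !exprS; lra.
by rewrite lerXn2r ?nnegrE ?expR_ge0.
Qed.

Section grid_chaining.
Context (R : realType) (F : nat -> R -> R) (D Q rho e0 : R) (N0 : nat).
Hypotheses (Q0 : 0 < Q) (D0 : 0 <= D) (N00 : (0 < N0)%N).
Hypothesis rho1 : 2^-1 <= rho < 1.
Hypotheses (DQ : 4 * D * Q / N0%:R <= (1 - rho) / 2)
  (e0rho : 0 < e0 <= (1 - rho) / 32).
Hypotheses (F_gt0 : forall n q, 0 < F n q) (F0 : forall q, F 0 q = 1).
Hypothesis F_lip : forall n q q', - Q <= q <= Q -> - Q <= q' <= Q ->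
  `|ln (F n q) - ln (F n q')| <= D * n%:R * `|q - q'|.

(** The mesh shrinks by 4 in each generation so that the Lipschitz error stays geometric: (n + 1) /
    4^n <= 2^-n <= rho^n. *)
Definition grid n k : R := - Q + 2 * Q * k%:R / (N0 * 4 ^ n)%:R.

Hypothesis F_step : forall n k, (k < N0 * 4 ^ n)%N -> F n (grid n k) <= 8 ->
  `|F n.+1 (grid n k) - F n (grid n k)| <= e0 * rho ^+ n.

Lemma grid_itv n k : (k < N0 * 4 ^ n)%N -> - Q <= grid n k <= Q.
Proof.
move=> kN; have N0' : 0 < (N0 * 4 ^ n)%:R :> R by rewrite ltr0n (leq_ltn_trans _ kN).
have : 0 <= 2 * Q * k%:R / (N0 * 4 ^ n)%:R <= 2 * Q.
  rewrite divr_ge0 ?mulr_ge0 ?(ltW Q0)//= ler_pdivrMr//.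
  by rewrite ler_pM2l ?mulr_gt0// ler_nat ltnW.
by rewrite /grid => /andP[h1 h2]; apply/andP; split; lra.
Qed.

Lemma grid_approx n q : - Q <= q < Q -> exists2 k, (k < N0 * 4 ^ n)%N &
  `|q - grid n k| <= 2 * Q / (N0 * 4 ^ n)%:R.
Proof.
move=> /andP[q1 q2]; set N := (N0 * 4 ^ n)%N.
have N_gt0 : (0 < N)%N by rewrite muln_gt0 N00 expn_gt0.
have NR0 : 0 < N%:R :> R by rewrite ltr0n.
pose t := (q + Q) / (2 * Q) * N%:R.
have Q20 : 0 < 2 * Q by rewrite mulr_gt0.
have t0 : 0 <= t by rewrite mulr_ge0// divr_ge0// ?(ltW Q20)//; lra.
have /andP[k1 k2] := truncn_itv t0.
exists (Num.truncn t).
  rewrite -(ltr_nat R) (le_lt_trans k1)// /t -[ltRHS]mul1r ltr_pM2r//.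
  by rewrite ltr_pdivrMr// mul1r; lra.
have -> : q - grid n (Num.truncn t) = (t - (Num.truncn t)%:R) * (2 * Q / N%:R).
  by rewrite /grid -/N /t; field; rewrite !lt0r_neq0.
have h0 : 0 <= 2 * Q / N%:R by rewrite divr_ge0// ltW.
rewrite normrM (ger0_norm h0) -[leRHS]mul1r ler_wpM2r//.
rewrite ler_norml; apply/andP; split; first by lra.
by rewrite lerBlDl -natr1 addrC in k2 *; lra.
Qed.

(** Going from [q] to a neighbouring grid point and back costs (1 - rho) rho^n / 4 each way, and the
    step taken at the grid point costs (1 - rho) rho^n / 2; together this is rho^n - rho^(n+1). The
    induction hypothesis itself bounds [F n] by 8 at the grid point, which is what [F_step] asks
    for. *)
Lemma grid_chaining n q : - Q <= q < Q -> `|ln (F n q)| <= 1 - rho ^+ n.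
Proof.
move=> qQ; have /andP[rho_ge rho_lt] := rho1; have /andP[e00 e0le] := e0rho.
have rho0 : 0 < rho by apply: lt_le_trans rho_ge.
have qQ' : - Q <= q <= Q by have /andP[h1 h2] := qQ; rewrite h1 ltW.
elim: n => [|n IHn]; first by rewrite F0 ln1 normr0 expr0 subrr.
have [k kN qk] := grid_approx n qQ.
set q' := grid n k in qk.
have q'Q : - Q <= q' <= Q by exact: grid_itv.
have r0 : 0 < rho ^+ n by rewrite exprn_gt0.
have r1 : rho ^+ n <= 1 by rewrite exprn_ile1// ltW.
have Nk0 : 0 < N0%:R :> R by rewrite ltr0n.
have dlt : D * n.+1%:R * `|q - q'| <= (1 - rho) / 4 * rho ^+ n.
  apply: (@le_trans _ _ (D * n.+1%:R * (2 * Q / (N0 * 4 ^ n)%:R))).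
    by rewrite ler_wpM2l// mulr_ge0.
  have h : n.+1%:R / (4 ^ n)%:R <= rho ^+ n.
    apply: (@le_trans _ _ (2^-1 ^+ n)); last first.
      by rewrite lerXn2r ?nnegrE ?invr_ge0// ltW.
    rewrite ler_pdivrMr ?ltr0n ?expn_gt0// natrX -exprMn.
    have -> : 2^-1 * 4 = 2 :> R by lra.
    by rewrite -natrX ler_nat ltn_expl.
  have -> : D * n.+1%:R * (2 * Q / (N0 * 4 ^ n)%:R) =
      (2 * D * Q / N0%:R) * (n.+1%:R / (4 ^ n)%:R).
    have M0 : 0 < (4 ^ n)%:R :> R by rewrite ltr0n expn_gt0.
    rewrite natrM; set M := (4 ^ n)%:R in M0 *.
    by field; rewrite !lt0r_neq0.
  apply: ler_pM => //.
  - by rewrite divr_ge0// !mulr_ge0// ltW.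
  - by have := DQ; rewrite -!mulrA; lra.
have dlt0 : D * n%:R * `|q - q'| <= (1 - rho) / 4 * rho ^+ n.
  apply: le_trans dlt; apply: ler_wpM2r => //.
  by rewrite ler_wpM2l// ler_nat.
have l1 := le_trans (F_lip n qQ' q'Q) dlt0.
have l2 := le_trans (F_lip n.+1 qQ' q'Q) dlt.
have p1 : (1 - rho) / 4 * rho ^+ n <= 8^-1.
  apply: (@le_trans _ _ ((1 - rho) / 4 * 1)); last by lra.
  by rewrite ler_wpM2l//; lra.
have lq' : `|ln (F n q')| <= 3 / 2.
  have -> : ln (F n q') = ln (F n q) - (ln (F n q) - ln (F n q')) by ring.
  apply: le_trans (ler_normB _ _) _.
  by lra.
have /andP[lq1 lq2] : - (3 / 2) <= ln (F n q') <= 3 / 2 by rewrite -ler_norml.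
have F8 : F n q' <= 8.
  rewrite -[F n q']lnK ?posrE// (le_trans _ (expR_3half_le8 R))//.
  by rewrite ler_expR.
have F8' : 8^-1 <= F n q'.
  rewrite -[F n q']lnK ?posrE//.
  apply: (@le_trans _ _ (expR (- (3 / 2)))); last by rewrite ler_expR.
  by rewrite expRN lef_pV2 ?posrE ?expR_gt0// expR_3half_le8.
have st := F_step kN F8; rewrite -/q' in st.
have e1 : e0 * rho ^+ n <= e0 by rewrite -[leRHS]mulr1 ler_pM2l.
have F16 : 16^-1 <= F n.+1 q'.
  have : `|F n.+1 q' - F n q'| <= 16^-1 by apply: (le_trans st); lra.
  by rewrite ler_norml => /andP[h1 _]; lra.
(* Both values are at least 1/16, so passing to logarithms costs a factor 16; hence the bound (1 -
   rho) / 32 imposed on [e0]. *)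
have l3 : `|ln (F n.+1 q') - ln (F n q')| <= (1 - rho) / 2 * rho ^+ n.
  apply: (@le_trans _ _ (`|F n.+1 q' - F n q'| / 16^-1)).
    by apply: ler_norm_lnB => //; lra.
  rewrite invrK; apply: (@le_trans _ _ (e0 * rho ^+ n * 16)).
    by rewrite ler_wpM2r.
  have -> : e0 * rho ^+ n * 16 = (16 * e0) * rho ^+ n by ring.
  by rewrite ler_wpM2r ?(ltW r0)//; lra.
have -> : ln (F n.+1 q) = (ln (F n.+1 q) - ln (F n.+1 q')) +
   (ln (F n.+1 q') - ln (F n q')) - (ln (F n q) - ln (F n q')) + ln (F n q).
  by ring.
apply: le_trans (ler_normD _ _) _.
have t1 := ler_normB (ln (F n.+1 q) - ln (F n.+1 q') +
  (ln (F n.+1 q') - ln (F n q'))) (ln (F n q) - ln (F n q')).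
have t2 := ler_normD (ln (F n.+1 q) - ln (F n.+1 q')) (ln (F n.+1 q') - ln (F n q')).
have -> : rho ^+ n.+1 = rho ^+ n - (1 - rho) * rho ^+ n by rewrite exprS; ring.
by lra.
Qed.

End grid_chaining.

Section path_bounds.
Context (R : realType) (b : nat).
Hypothesis b0 : (0 < b)%N.

Lemma wt_le_scale (V V' : seq 'I_b -> 'I_b -> R) (c : R) w v : 0 <= c ->
  (forall u i, 0 <= V u i <= c * V' u i) ->
  0 <= wt V w v <= c ^+ size v * wt V' w v.
Proof.
move=> c0 h; elim: v w => [|i v IHv] w /=; first by rewrite mul1r ler01 lexx.
have /andP[h1 h2] := h w i; have /andP[h3 h4] := IHv (rcons w i).
rewrite mulr_ge0//= exprS mulrACA; exact: ler_pM.
Qed.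

Lemma flat_wt_gt0 (V : seq 'I_b -> 'I_b -> R) m n w :
  (forall u i, 0 < V u i) -> 0 < flat_wt V m n w.
Proof.
move=> V0; rewrite mulr_gt0 ?invr_gt0 ?exprn_gt0 ?ltr0n//.
have t0 u : 0 <= total_wt V n (w ++ u) by exact/ltW/total_wt_gt0.
rewrite lt0r sumr_ge0// andbT psumr_neq0//; apply/hasP.
by exists [tuple of nseq m (Ordinal b0)]; rewrite ?mem_index_enum//= total_wt_gt0.
Qed.

Lemma flat_wt_le_scale (V V' : seq 'I_b -> 'I_b -> R) (c : R) m n w : 0 <= c ->
  (forall u i, 0 <= V u i <= c * V' u i) ->
  flat_wt V m n w <= c ^+ n * flat_wt V' m n w.
Proof.
move=> c0 h; rewrite /flat_wt mulrCA ler_wpM2l ?invr_ge0 ?exprn_ge0//.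
rewrite mulr_sumr; apply: ler_sum => u _; rewrite mulr_sumr.
apply: ler_sum => v _.
by have /andP[_] := wt_le_scale (w ++ u) v c0 h; rewrite size_tuple.
Qed.

Lemma total_flat_wt (V : seq 'I_b -> 'I_b -> R) (kappa : R) m n w :
  (forall u i, expR (- kappa) / b%:R <= V u i <= expR kappa / b%:R) ->
  `|ln (total_wt V (m + n) w) - ln (flat_wt V m n w)| <= kappa * m%:R.
Proof.
move=> h; have bR0 : 0 < b%:R :> R by rewrite ltr0n.
have c0 k : 0 < expR k / b%:R := divr_gt0 (expR_gt0 k) bR0.
have V0 u i : 0 < V u i by have /andP[/(lt_le_trans (c0 _))] := h u i.
have F0 := flat_wt_gt0 m n w V0.
have T0 := total_wt_gt0 (m + n) w b0 V0.
have sc k : (expR k / b%:R) ^+ m * \sum_(u : m.-tuple 'I_b) total_wt V n (w ++ u)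
    = expR (k * m%:R) * flat_wt V m n w.
  by rewrite /flat_wt exprMn mulrA expRM_natr exprVn.
have lo : expR (- kappa * m%:R) * flat_wt V m n w <= total_wt V (m + n) w.
  rewrite -sc total_wt_cat mulr_sumr; apply: ler_sum => u _.
  rewrite ler_wpM2r//; first exact/ltW/total_wt_gt0.
  by have /andP[] := wt_bounds w u (ltW (c0 _)) h; rewrite size_tuple.
have hi : total_wt V (m + n) w <= expR (kappa * m%:R) * flat_wt V m n w.
  rewrite -sc total_wt_cat mulr_sumr; apply: ler_sum => u _.
  rewrite ler_wpM2r//; first exact/ltW/total_wt_gt0.
  by have /andP[] := wt_bounds w u (ltW (c0 _)) h; rewrite size_tuple.
have lnE k : ln (expR k * flat_wt V m n w) = k + ln (flat_wt V m n w).
  by rewrite lnM ?posrE ?expR_gt0// expRK.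
rewrite ler_norml; apply/andP; split.
  by rewrite -mulNr lerBrDr -lnE ler_ln ?posrE//;
    exact: mulr_gt0 (expR_gt0 _) F0.
by rewrite lerBlDr -lnE ler_ln ?posrE//;
    exact: mulr_gt0 (expR_gt0 _) F0.
Qed.

Variables (V : R -> seq 'I_b -> 'I_b -> R) (kappa D Q rho e0 : R) (N0 m : nat)
  (w : seq 'I_b).
Hypotheses (Q0 : 0 < Q) (D0 : 0 <= D) (N00 : (0 < N0)%N).
Hypothesis rho1 : 2^-1 <= rho < 1.
Hypotheses (DQ : 4 * D * Q / N0%:R <= (1 - rho) / 2)
  (e0rho : 0 < e0 <= (1 - rho) / 32).
Hypothesis Vkappa : forall q, - Q <= q <= Q -> forall u i,
  expR (- kappa) / b%:R <= V q u i <= expR kappa / b%:R.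
Hypothesis VD : forall q q', - Q <= q <= Q -> - Q <= q' <= Q -> forall u i,
  V q u i <= expR (D * `|q - q'|) * V q' u i.
Hypothesis V_step : forall n k, (k < N0 * 4 ^ n)%N ->
  let V' := V (grid Q N0 n k) in flat_wt V' m n w <= 8 ->
  `|flat_wt V' m n.+1 w - flat_wt V' m n w| <= e0 * rho ^+ n.

Lemma total_wt_bound n q : - Q <= q < Q ->
  `|ln (total_wt (V q) (m + n) w)| <= kappa * m%:R + 1.
Proof.
move=> qQ; have bR0 : 0 < b%:R :> R by rewrite ltr0n.
have V0 q' : - Q <= q' <= Q -> forall u i, 0 < V q' u i.
  move=> q'Q u i; have /andP[+ _] := Vkappa q'Q u i.
  by apply: lt_le_trans; exact: divr_gt0 (expR_gt0 _) bR0.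
(* Extended by 1 because [grid_chaining] requires positivity and the initial value 1 at every real
   parameter. *)
pose F n q := if - Q <= q <= Q then flat_wt (V q) m n w else 1.
have FE n' q' : - Q <= q' <= Q -> F n' q' = flat_wt (V q') m n' w.
  by rewrite /F => ->.
have qQ' : - Q <= q <= Q by have /andP[h1 h2] := qQ; rewrite h1 ltW.
have F_gt0 n' q' : 0 < F n' q'.
  by rewrite /F; case: ifPn => // q'Q; apply: flat_wt_gt0; exact: V0.
have F0 q' : F 0 q' = 1.
  by rewrite /F; case: ifPn => // q'Q; rewrite flat_wt0.
have F_lip n' q1 q2 : - Q <= q1 <= Q -> - Q <= q2 <= Q ->
    `|ln (F n' q1) - ln (F n' q2)| <= D * n'%:R * `|q1 - q2|.
  move=> q1Q q2Q; rewrite !FE//.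
  have h x y : - Q <= x <= Q -> - Q <= y <= Q ->
    ln (flat_wt (V x) m n' w) - ln (flat_wt (V y) m n' w)
      <= D * n'%:R * `|x - y|.
    move=> xQ yQ; have x0 := flat_wt_gt0 m n' w (V0 _ xQ).
    have y0 := flat_wt_gt0 m n' w (V0 _ yQ).
    rewrite lerBlDr mulrAC -[X in X + _]expRK -lnM ?posrE ?expR_gt0//.
    rewrite ler_ln ?posrE//; last exact: mulr_gt0 (expR_gt0 _) y0.
    rewrite expRM_natr.
    apply: flat_wt_le_scale; first exact: expR_ge0.
    by move=> u i; rewrite VD// andbT ltW// V0.
  rewrite ler_norml h// andbT lerNl opprB distrC; exact: h.
have F_step n' k : (k < N0 * 4 ^ n')%N -> F n' (grid Q N0 n' k) <= 8 ->
    `|F n'.+1 (grid Q N0 n' k) - F n' (grid Q N0 n' k)| <= e0 * rho ^+ n'.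
  by move=> kN; have gQ := grid_itv Q0 kN; rewrite !FE//; exact: V_step.
have := grid_chaining Q0 D0 N00 rho1 DQ e0rho F_gt0 F0 F_lip F_step n qQ.
rewrite FE// => h.
have h' := total_flat_wt m n w (Vkappa qQ').
have -> : ln (total_wt (V q) (m + n) w) =
  (ln (total_wt (V q) (m + n) w) - ln (flat_wt (V q) m n w)) +
  ln (flat_wt (V q) m n w) by rewrite subrK.
apply: le_trans (ler_normD _ _) _; apply: lerD => //.
apply: (le_trans h); rewrite gerBl exprn_ge0//.
by have /andP[+ _] := rho1; apply: le_trans.
Qed.

End path_bounds.

(** * Moments *)

Section superlinear.
Context (R : realType) (tau : R -> R).
Hypothesis dtau : forall q, derivable tau q 1.
Hypothesis tau_gt0 : forall q, 0 < derive1 tau q * q - tau q.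

(* [p |-> tau (p q) / p] has derivative
   [(p q tau' (p q) - tau (p q)) / p ^ 2 > 0]. *)
Lemma double_lt q : 2 * tau q < tau (2 * q).
Proof.
pose g : R -> R := (fun p : R => tau (p * q)) * (fun p : R => p^-1).
pose dg (p : R) : R := (derive1 tau (p * q) * (p * q) - tau (p * q)) / p ^+ 2.
have gE (p : R) : 0 < p -> is_derive p 1 g (dg p).
  move=> p0; rewrite /g.
  have h1 : is_derive p 1 (fun p : R => tau (p * q)) (derive1 tau (p * q) * q).
    apply: (@is_derive1_comp _ tau ( *%R ^~ q)).
      by rewrite derive1E; exact: derivableP.
    have := @is_deriveM _ _ id (cst q) p 1 _ _ (is_derive_id _ _) (is_derive_cst _ _ _).
    by move=> h; apply: is_derive_eq; rewrite scaler0 add0r -[_ *: _]/(_ * _) mulr1.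
  have h2 : is_derive p 1 (fun p : R => p^-1) (- p ^- 2).
    have p_neq0 : p != 0 by rewrite lt0r_neq0.
    have := @is_deriveV _ id p 1 1 p_neq0 (is_derive_id _ _).
    by move=> h; apply: is_derive_eq; rewrite -[_ *: _]/(_ * _) mulr1.
  have := is_deriveM h1 h2; move=> h; apply: is_derive_eq.
  rewrite -[X in X + _]/(_ * _) -[X in _ + X]/(_ * _) /dg.
  by field; rewrite lt0r_neq0.
have c : {within `[1, 2], continuous g}.
  apply: derivable_within_continuous => p; rewrite in_itv/= => /andP[p1 _].
  by have [] := gE p (lt_le_trans ltr01 p1).
have lt12 : 1 < 2 :> R by lra.
have dgE (p : R) : p \in `]1, 2[ -> is_derive p 1 g (dg p).
  rewrite in_itv/= => /andP[p1 _].
  exact: gE (lt_trans ltr01 p1).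
have [p] := MVT lt12 dgE c.
rewrite in_itv/= => /andP[p1 _].
have p0 := lt_trans ltr01 p1.
have : 0 < dg p by rewrite divr_gt0 ?exprn_gt0.
rewrite /g -[X in X - _]/(_ * _) -[X in _ - X]/(_ * _) mul1r.
by lra.
Qed.

(** The strict inequality of [double_lt] becomes uniform because the continuous difference attains
    its maximum on the compact interval. *)
Lemma double_gap (Q : R) : 0 < Q -> exists2 c, 0 < c &
  forall q, - Q <= q <= Q -> tau q + c <= tau (2 * q) / 2.
Proof.
move=> Q0; pose psi (q : R) : R := tau q - tau (2 * q) / 2.
have cpsi : {within `[- Q, Q], continuous psi}.
  apply: derivable_within_continuous => q _.
  apply: derivableB => //.
  have h : is_derive q 1 (fun q : R => tau (2 * q)) (derive1 tau (2 * q) * 2).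
    apply: (@is_derive1_comp _ tau ( *%R 2)).
      by rewrite derive1E; exact: derivableP.
    have := @is_deriveM _ _ (cst 2) id q 1 _ _ (is_derive_cst _ _ _) (is_derive_id _ _).
    by move=> h; apply: is_derive_eq; rewrite scaler0 addr0 -[_ *: _]/(_ * _) mulr1.
  by apply: derivableM => //; exact: derivable_cst.
have QQ : - Q <= Q by lra.
have [m _ hm] := EVT_max QQ cpsi.
exists (- psi m); first by have := double_lt m; rewrite /psi; lra.
by move=> q qQ; have := hm q; rewrite in_itv/= => /(_ qQ); rewrite /psi; lra.
Qed.

(** The first doubling is kept apart: there [double_gap] gains its constant, while the later ones
    only have to preserve it. *)
Lemma doubling_iter q k : 2 ^+ k * tau (2 * q) <= tau (2 ^+ k.+1 * q).
Proof.
elim: k => [|k IHk]; first by rewrite expr0 mul1r expr1.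
have -> : 2 ^+ k.+2 * q = 2 * (2 ^+ k.+1 * q) by rewrite [2 ^+ k.+2]exprS mulrA.
rewrite [X in X * tau _]exprS -mulrA.
apply: le_trans (ltW (double_lt _)).
by rewrite ler_pM2l.
Qed.

End superlinear.

Lemma ae_forall_countable (d : measure_display) (T : measurableType d)
    (R : realType) (mu : {measure set T -> \bar R}) (I : countType)
    (Pr : I -> T -> Prop) :
  (forall i, {ae mu, forall x, Pr i x}) -> {ae mu, forall x, forall i, Pr i x}.
Proof.
move=> h; have : {ae mu, forall x, forall n, forall i, unpickle n = Some i -> Pr i x}.
  apply: ae_foralln => n; case: (unpickle n) => [i|]; last by apply: aeW.
  by move: (h i); apply: filterS => x Px j [<-].
by apply: filterS => x Px i; apply: (Px (pickle i)); rewrite pickleK.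
Qed.

Lemma powR_le_scale (R : realType) (A x q q' : R) : 1 < A -> A^-1 <= x <= A ->
  x `^ q <= expR (ln A * `|q - q'|) * x `^ q'.
Proof.
move=> A1 /andP[x1 x2]; have A0 : 0 < A := lt_trans ltr01 A1.
have x0 : 0 < x by apply: lt_le_trans x1; rewrite invr_gt0.
rewrite /powR (gt_eqF x0) -expRD ler_expR -lerBlDr -mulrBl mulrC.
apply: le_trans (ler_norm _) _; rewrite normrM ler_wpM2r// ler_norml.
rewrite lerNl -lnV ?posrE// !ler_ln ?posrE ?invr_gt0// -[leRHS]invrK.
by rewrite lef_pV2 ?posrE ?invr_gt0// x2 x1.
Qed.

Lemma eq0_of_mulrn_bounded (R : realType) (p c : R) : 0 <= p -> 0 < c ->
  (forall n, p * (c * n%:R) <= 1) -> p = 0.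
Proof.
move=> p0 c0 h; apply/eqP; rewrite eq_le p0 andbT leNgt; apply/negP => {}p0.
have pc : 0 < p * c by rewrite mulr_gt0.
have := h (Num.truncn (p * c)^-1).+1; rewrite leNgt => /negP; apply.
by rewrite mulrA mulrC -ltr_pdivrMr// div1r truncnS_gt.
Qed.

Section moments.
Context (R : realType) (b : nat) (hb : (1 < b)%N) (d0 : measure_display)
  (T0 : measurableType d0) (P0 : probability T0 R)
  (W0 : {mfun T0 >-> b.-tuple (measurableTypeR R)}) (A : R).
Hypotheses (A1 : 1 < A)
  (W0A : {ae P0, forall x, forall k : 'I_b, A^-1 <= (tnth (W0 x) k : R) <= A}).

Definition moment_sum (q : R) (x : T0) : R :=
  \sum_(k < b) (tnth (W0 x) k : R) `^ q.

Definition phi (q : R) : R := fine (\int[P0]_x (moment_sum q x)%:E).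

Lemma measurable_tnth_powR (k : 'I_b) q :
  measurable_fun setT (fun y : b.-tuple (measurableTypeR R) => (tnth y k : R) `^ q).
Proof.
apply: (@measurableT_comp _ _ _ _ _ _ (@powR R ^~ q)); first exact: measurable_powR.
exact: measurable_tnth.
Qed.

Lemma measurable_moment_sum q : measurable_fun setT (moment_sum q).
Proof.
apply: measurable_sum => k.
exact: (measurableT_comp (measurable_tnth_powR k q)).
Qed.

Lemma moment_sum_ge0 q x : 0 <= moment_sum q x.
Proof. by rewrite sumr_ge0// => k _; exact: powR_ge0. Qed.

Lemma moment_le_scale q q' :
  (\int[P0]_x (moment_sum q x)%:E <=
   (expR (ln A * `|q - q'|))%:E * \int[P0]_x (moment_sum q' x)%:E)%E.
Proof.
have mS q1 : measurable_fun setT (fun x => (moment_sum q1 x)%:E).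
  by apply/measurable_EFinP; exact: measurable_moment_sum.
have S0 q1 x : (0 <= (moment_sum q1 x)%:E)%E by rewrite lee_fin moment_sum_ge0.
rewrite -ge0_integralZl_EFin ?expR_ge0//.
apply: ae_ge0_le_integral => //.
- by move=> x _; rewrite mule_ge0// lee_fin expR_ge0.
- by apply/measurable_EFinP; apply: measurable_funM => //; exact: measurable_moment_sum.
move: W0A; apply: filterS => x Wx _.
rewrite -EFinM lee_fin /moment_sum mulr_sumr; apply: ler_sum => k _.
exact: powR_le_scale.
Qed.

Lemma moment0 : (\int[P0]_x (moment_sum 0 x)%:E = b%:R%:E)%E.
Proof.
under eq_integral => x _.
  rewrite /moment_sum; under eq_bigr do rewrite powRr0.
  rewrite sumr_const card_ord; over.
by rewrite integral_cst// [X in (_ * X)%E]probability_setT mule1.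
Qed.

Lemma phiE q : (\int[P0]_x (moment_sum q x)%:E = (phi q)%:E)%E.
Proof.
rewrite /phi fineK// ge0_fin_numE.
  by rewrite (le_lt_trans (moment_le_scale q 0))// moment0 -EFinM ltry.
by apply: integral_ge0 => x _; rewrite lee_fin moment_sum_ge0.
Qed.

Lemma phi0 : phi 0 = b%:R.
Proof. by rewrite /phi moment0. Qed.

Lemma phi_le_scale q q' : phi q <= expR (ln A * `|q - q'|) * phi q'.
Proof. by have := moment_le_scale q q'; rewrite !phiE -EFinM lee_fin. Qed.

Lemma phi_bounds q :
  b%:R * expR (- (ln A * `|q|)) <= phi q <= b%:R * expR (ln A * `|q|).
Proof.
have := phi_le_scale q 0; rewrite subr0 phi0 mulrC => ->; rewrite andbT.
have := phi_le_scale 0 q; rewrite sub0r normrN phi0.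
by rewrite expRN ler_pdivrMr ?expR_gt0// mulrC.
Qed.

Lemma phi_gt0 q : 0 < phi q.
Proof.
have /andP[+ _] := phi_bounds q; apply: lt_le_trans.
by rewrite mulr_gt0 ?expR_gt0// ltr0n ltnW.
Qed.

Lemma ttauE q : ttau P0 W0 q = (- (ln (phi q) / ln b%:R))%:E.
Proof.
rewrite /ttau /logb.
have -> : ('E_P0[fun x => (\sum_(k < b) tnth (W0 x) k `^ q)%R] = (phi q)%:E)%E.
  by rewrite unlock -phiE.
by rewrite lne_EFin ?phi_gt0// -EFinM -EFinN.
Qed.

Lemma b_powR_ttau q : b%:R `^ fine (ttau P0 W0 q) = (phi q)^-1.
Proof.
rewrite ttauE/= /powR pnatr_eq0 gtn_eqF ?(ltnW hb)//.
rewrite mulNr divfK ?expRN ?lnK ?posrE ?phi_gt0//.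
by rewrite lt0r_neq0// ln_gt0// ltr1n.
Qed.

(** Markov's inequality for the [n]-th power of W_k^q, whose mean is at most that of the sum of
    W_i^{nq} over all letters [i]. *)
Lemma powR_law_le q (k : 'I_b) (t : R) (n : nat) : 0 <= t ->
  (P0 [set x | (t < tnth (W0 x) k `^ q)%R] * (t ^+ n)%:E <= (phi (n%:R * q))%:E)%E.
Proof.
move=> t0; set S := [set x | _].
have mk q1 : measurable_fun setT (fun x => (tnth (W0 x) k : R) `^ q1).
  exact: (measurableT_comp (measurable_tnth_powR k q1)).
have mS : measurable S.
  rewrite -[X in measurable X]setTI.
  have := @measurable_fun_ltr _ _ _ setT _ _ (measurable_cst t) (mk q).
  by move=> /(_ measurableT [set true]); rewrite setTI; apply.
rewrite muleC -integral_cst// -phiE integral_mkcond.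
apply: ge0_le_integral => //.
- by move=> x _; rewrite patchE; case: ifP => // _; rewrite lee_fin exprn_ge0.
- by apply/(measurable_restrictT _ mS).
- by apply/measurable_EFinP; exact: measurable_moment_sum.
move=> x _; rewrite patchE; case: ifPn => [|_].
  rewrite inE /S/= => tx; rewrite lee_fin /moment_sum (bigD1 k)//= ler_wpDr//.
    by rewrite sumr_ge0// => i _; exact: powR_ge0.
  rewrite mulrC powRrM powR_mulrn ?powR_ge0// lerXn2r ?nnegrE ?powR_ge0//.
  exact: ltW.
by rewrite lee_fin moment_sum_ge0.
Qed.

Hypothesis J_full : Jset P0 W0 = setT.

Let tau q : R := - (ln (phi q) / ln b%:R).

Lemma fine_ttau : fine \o ttau P0 W0 = tau.
Proof. by apply/funext => q /=; rewrite ttauE. Qed.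

Lemma J_tau q : derivable tau q 1 /\ 0 < derive1 tau q * q - tau q.
Proof.
have : Jset P0 W0 q by rewrite J_full.
move=> /interior_subset[_]; rewrite fine_ttau => ? h; split => //.
by move: h; rewrite ttauE.
Qed.

(* The L^p norms of the weights are controlled along p = 2 ^ k by doubling_iter;
   letting k go to infinity bounds the essential supremum. *)
Lemma weight_sup (Q : R) : 0 < Q -> exists2 r, 0 < r < 1 &
  forall q, - Q <= q <= Q ->
  {ae P0, forall x, forall k : 'I_b, (tnth (W0 x) k : R) `^ q / phi q <= r}.
Proof.
move=> Q0.
have tau1 q := (J_tau q).1; have tau2 q := (J_tau q).2.
have [c c0 hc] := double_gap tau1 tau2 Q0.
have lb0 : 0 < ln b%:R :> R by rewrite ln_gt0// ltr1n.
have c'0 : 0 < c * ln b%:R by rewrite mulr_gt0.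
(* For p = 2^(n+1) the gap yields phi(p q) <= phi(q)^p b^(-c p), so the L^p norm of the normalized
   weight is at most b^-c. Taking b^(-c/2) as the bound leaves a probability of at most b^(-c p / 2)
   for exceeding it, which tends to 0. *)
exists (expR (- (c * ln b%:R / 2))).
  by rewrite expR_gt0 expR_lt1; lra.
move=> q qQ.
apply: ae_forall_countable => k.
set r := expR _.
have r0 : 0 < phi q * r by rewrite mulr_gt0 ?phi_gt0 ?expR_gt0.
pose S := [set x | (phi q * r < (tnth (W0 x) k : R) `^ q)%R].
have mS : measurable S.
  have mk : measurable_fun setT (fun x => (tnth (W0 x) k : R) `^ q).
    exact: (measurableT_comp (measurable_tnth_powR k q)).
  have := @measurable_fun_ltr _ _ _ setT _ _ (measurable_cst (phi q * r)) mk.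
  by move=> /(_ measurableT [set true]); rewrite setTI; apply.
suff PS : P0 S = 0%E.
  apply: (@negligibleS _ _ _ _ S); last by apply/negligibleP.
  move=> x /= /negP; rewrite -ltNge ltr_pdivlMr ?phi_gt0//.
  by rewrite mulrC.
have PSE : P0 S = (fine (P0 S))%:E by rewrite fineK// fin_num_measure.
rewrite PSE; congr EFin.
apply: (@eq0_of_mulrn_bounded _ _ (c * ln b%:R)) => [|//|n]; first exact: fine_ge0.
have pw n' : n'%:R <= 2 ^+ n' :> R by rewrite -natrX ler_nat ltnW// ltn_expl.
have := powR_law_le q k (2 ^ n.+1) (ltW r0).
rewrite -/S PSE -EFinM lee_fin => h1.
have h2 : ln (phi ((2 ^ n.+1)%:R * q)) <= 2 ^+ n.+1 * (ln (phi q) - c * ln b%:R).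
  have it := doubling_iter tau1 tau2 q n.
  have gp0 : 2 * (tau q + c) <= tau (2 * q).
    by rewrite mulrC -ler_pdivlMr//; exact: hc.
  have gp := ler_wpM2l (exprn_ge0 n (ltW (ltr0Sn R 1))) gp0.
  have := le_trans gp it; rewrite /tau natrX mulrA -exprSr => h3.
  have -> : 2 ^+ n.+1 * (ln (phi q) - c * ln b%:R) =
    - (2 ^+ n.+1 * (- (ln (phi q) / ln b%:R) + c) * ln b%:R).
    by field; rewrite lt0r_neq0.
  by rewrite lerNr -ler_pdivlMr// mulNr.
have h4 : (phi q * r) ^+ (2 ^ n.+1) = expR (2 ^+ n.+1 * (ln (phi q) - c * ln b%:R / 2)).
  rewrite -[X in expR (X * _)]natrX expRM_natl expRD lnK ?posrE ?phi_gt0//.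
rewrite h4 in h1.
have h5 : phi ((2 ^ n.+1)%:R * q) <= expR (2 ^+ n.+1 * (ln (phi q) - c * ln b%:R)).
  by rewrite -[leLHS]lnK ?posrE ?phi_gt0// ler_expR.
have {h1 h5}h6 : fine (P0 S) * expR (c * ln b%:R * 2 ^+ n) <= 1.
  have := le_trans h1 h5.
  move=> h6; have := ler_wpM2r (expR_ge0 (- (2 ^+ n.+1 * (ln (phi q) - c * ln b%:R)))) h6.
  rewrite -(mulrA (fine _)) -!expRD subrr expR0.
  suff -> : c * ln b%:R * 2 ^+ n = 2 ^+ n.+1 * (ln (phi q) - c * ln b%:R / 2) -
    2 ^+ n.+1 * (ln (phi q) - c * ln b%:R) by [].
  by rewrite exprS; field.
apply: le_trans h6; apply: ler_wpM2l; first by rewrite /= fine_ge0.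
apply: le_trans (expR_ge1Dx _); rewrite -[leLHS]add0r lerD//.
by rewrite ler_wpM2l// ltW.
Qed.

End moments.

(** * Logarithmic bound for the total masses *)

(** Completing the square gives n L - c n^2 <= L^2 / (4 c) with L = ln (2 B); the 2 inside the
    logarithm pays for the summable factor on the right. *)
Lemma gaussian_beats_geometric (R : realType) (B c : R) : 0 < B -> 0 < c ->
  exists2 C, 0 < C & forall n, B ^+ n * expR (- (c * n%:R ^+ 2)) <= C / 2 ^+ n.+1.
Proof.
move=> B0 c0; pose L := ln (2 * B).
exists (2 * expR (L ^+ 2 / (4 * c))) => [|n]; first by rewrite mulr_gt0 ?expR_gt0.
rewrite ler_pdivlMr ?exprn_gt0// (exprS _ n) mulrCA ler_pM2l// mulrAC -exprMn.
rewrite [B * 2]mulrC -[2 * B]lnK ?posrE ?mulr_gt0// -/L -expRM_natl -expRD ler_expR.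
rewrite ler_pdivlMr ?mulr_gt0// -subr_ge0.
have -> : L ^+ 2 - (n%:R * L - c * n%:R ^+ 2) * (4 * c) = (L - 2 * c * n%:R) ^+ 2.
  by ring.
exact: sqr_ge0.
Qed.

Lemma nneseries_half_le (R : realType) (u : (\bar R)^nat) (C : R) :
  (forall n, (0 <= u n <= (C / 2 ^+ n.+1)%:E)%E) ->
  (\sum_(0 <= n <oo) u n <= C%:E)%E.
Proof.
move=> uC; have := @cvg_geometric_eseries_half R C 0.
rewrite expr0 divr1 => /cvg_lim <-//.
apply: lee_nneseries => [n _ _|n _]; first by have /andP[] := uC n.
by have /andP[_] := uC n; rewrite addn1 natrX.
Qed.

Lemma borel_cantelli_double (d : measure_display) (T : measurableType d)
    (R : realType) (P : probability T R) (S : nat -> nat -> set T) (C : R) :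
  0 <= C -> (forall j n, measurable (S j n)) ->
  (forall j n, (P (S j n) <= (C / 2 ^+ j.+1 / 2 ^+ n.+1)%:E)%E) ->
  {ae P, forall x, \forall j \near \oo, forall n, ~ S j n x}.
Proof.
move=> C0 mS PS; pose E j := \bigcup_n S j n.
have mE j : measurable (E j) by exact: bigcup_measurable.
have PE j : (0 <= P (E j) <= (C / 2 ^+ j.+1)%:E)%E.
  rewrite measure_ge0/=; apply: le_trans (generalized_Boole_inequality P _ _) _ => //.
    exact: mE.
  by apply: nneseries_half_le => n; rewrite measure_ge0 PS.
have ls0 : P (lim_sup_set E) = 0%E.
  by apply: lim_sup_set_cvg0 => //; rewrite (le_lt_trans (nneseries_half_le PE))// ltry.
apply: (@negligibleS _ _ _ _ (lim_sup_set E)).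
  move=> x /= nx n _; apply: contrapT => nE; apply: nx.
  exists n => // j /= nj m Sjm; apply: nE; exists j => //.
  by exists m.
apply/negligibleP => //.
apply: bigcap_measurable => [|n _]; first by exists 0%N.
exact: bigcup_measurable.
Qed.

Lemma measure_bigsetU_le (d : measure_display) (T : measurableType d)
    (R : realType) (mu : {measure set T -> \bar R}) (I : Type) (s : seq I)
    (S : I -> set T) (p : R) : (forall i, measurable (S i)) ->
  (forall i, (mu (S i) <= p%:E)%E) ->
  (mu (\big[setU/set0]_(i <- s) S i) <= ((size s)%:R * p)%:E)%E.
Proof.
move=> mS hp; elim: s => [|i s IHs].
  by rewrite big_nil measure0 mul0r.
rewrite big_cons /= -natr1 mulrDl mul1r addrC EFinD.
apply: le_trans (measureU2 _ _ _) _ => //; first exact: bigsetU_measurable.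
exact: leeD (hp i) IHs.
Qed.

Lemma in_bigsetU (T : Type) (I : eqType) (s : seq I) (S : I -> set T) i x :
  i \in s -> S i x -> (\big[setU/set0]_(i <- s) S i) x.
Proof.
elim: s => // j s IHs; rewrite inE big_cons => /predU1P[->|si] Sx; first by left.
by right; exact: IHs.
Qed.

(* Chosen so that b ^ flat_depth j >= j ^ 2, which makes the exceptional
   probabilities beat the number b ^ j of words, while flat_depth j = O(ln j)
   costs only a power of j. *)
Definition flat_depth (j : nat) : nat := (2 * (trunc_log 2 j).+1)%N.

Lemma flat_depth_ge (R : realType) (b j : nat) : (1 < b)%N ->
  j%:R ^+ 2 <= b%:R ^+ flat_depth j :> R.
Proof.
move=> hb; rewrite -!natrX ler_nat /flat_depth mulnC expnM leq_exp2r//.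
apply: (@leq_trans (2 ^ (trunc_log 2 j).+1)); first exact/ltnW/trunc_log_ltn.
by rewrite leq_exp2r.
Qed.

(** The additive constant is absorbed by ln j >= ln 2, which doubles the factor 2 to 4. *)
Lemma flat_depth_le (R : realType) (j : nat) : (1 < j)%N ->
  (flat_depth j)%:R <= 4 / ln 2 * ln j%:R :> R.
Proof.
move=> j1; have ln2 : 0 < ln 2 :> R by rewrite ln_gt0// ltr1n.
have h : (trunc_log 2 j)%:R * ln 2 <= ln j%:R :> R.
  rewrite mulr_natl -lnXn// -natrX ler_ln ?posrE ?ltr0n ?expn_gt0 ?(ltnW j1)//.
  by rewrite ler_nat trunc_logP// ltnW.
have h2 : ln 2 <= ln j%:R :> R.
  by rewrite ler_ln ?posrE ?ltr0n ?(ltnW j1)// ler_nat.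
rewrite /flat_depth natrM -natr1 mulrAC ler_pdivlMr//.
by lra.
Qed.

Lemma bernoulli_ineq (R : realType) (t : R) n : 0 <= t -> 1 + n%:R * t <= (1 + t) ^+ n.
Proof.
move=> t0; elim: n => [|n IHn]; first by rewrite mul0r addr0 expr0.
rewrite exprS; apply: (@le_trans _ _ ((1 + t) * (1 + n%:R * t))).
  rewrite -natr1 -subr_ge0.
  have -> : (1 + t) * (1 + n%:R * t) - (1 + (n%:R + 1) * t) = n%:R * t ^+ 2 by ring.
  by rewrite mulr_ge0 ?sqr_ge0.
by rewrite ler_wpM2l// addr_ge0.
Qed.

(** From r <= rho^4 one gets rho^(2n) / r^n >= rho^(-2n), and Bernoulli's inequality bounds this
    below by 1 + (n t)^2 with t = 1 / rho - 1. The factor b^[flat_depth j] turns the 1 into j^2 and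
    is at least 1 in front of the other term. *)
Lemma step_exponent_ge (R : realType) (b j n : nat) (rho r c : R) :
  (1 < b)%N -> 0 < r -> 0 < rho < 1 -> r <= rho ^+ 4 -> 0 < c ->
  c * j%:R ^+ 2 + c * (rho^-1 - 1) ^+ 2 * n%:R ^+ 2 <=
  (c * (rho ^+ n) ^+ 2) / (b%:R ^- flat_depth j * r ^+ n).
Proof.
move=> hb r0 /andP[rho0 rho1] rrho c0.
have B1 : 1 <= b%:R ^+ flat_depth j :> R.
  by rewrite exprn_ege1// ler1n ltnW.
have Bj := flat_depth_ge R j hb.
set B := b%:R ^+ _ in B1 Bj *; have B0 : 0 < B := lt_le_trans ltr01 B1.
set t := rho^-1 - 1; have t0 : 0 <= t by rewrite subr_ge0 invf_ge1// ltW.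
have rn0 : 0 < r ^+ n by rewrite exprn_gt0.
have rhon0 : 0 < rho ^+ n by rewrite exprn_gt0.
have h1 : 1 + (n%:R * t) ^+ 2 <= (rho ^+ n) ^- 2.
  apply: (@le_trans _ _ ((1 + n%:R * t) ^+ 2)).
    rewrite -subr_ge0.
    have -> : (1 + n%:R * t) ^+ 2 - (1 + (n%:R * t) ^+ 2) = 2 * (n%:R * t) by ring.
    by rewrite !mulr_ge0.
  rewrite -exprVn lerXn2r ?nnegrE ?addr_ge0 ?mulr_ge0 ?invr_ge0 ?(ltW rhon0)//.
  apply: le_trans (bernoulli_ineq _ t0) _.
  by rewrite /t addrC subrK exprVn.
have h2 : (rho ^+ n) ^- 2 <= (rho ^+ n) ^+ 2 / r ^+ n.
  rewrite ler_pdivlMr// ler_pdivrMl ?exprn_gt0//.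
  have -> : (rho ^+ n) ^+ 2 * (rho ^+ n) ^+ 2 = (rho ^+ 4) ^+ n.
    by rewrite -!exprM -exprD; congr (_ ^+ _); lia.
  by rewrite lerXn2r ?nnegrE ?exprn_ge0 ?(ltW r0) ?(ltW rho0).
have -> : c * (rho ^+ n) ^+ 2 / (B^-1 * r ^+ n) = c * (B * ((rho ^+ n) ^+ 2 / r ^+ n)).
  clear -rn0 B0; move: (r ^+ n) rn0 => rn rn0; field.
  by rewrite !lt0r_neq0.
rewrite -mulrA -mulrDr ler_pM2l//.
have h3 := le_trans h1 h2.
apply: (@le_trans _ _ (B * (1 + (n%:R * t) ^+ 2))); last by rewrite ler_pM2l.
rewrite mulrDr mulr1 lerD// exprMn mulrC -[leLHS]mul1r ler_wpM2r//.
by rewrite mulr_ge0 ?sqr_ge0.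
Qed.

Section cascade_bound.
Context (R : realType) (b : nat) (hb : (1 < b)%N)
  (d0 d : measure_display) (T0 : measurableType d0) (T : measurableType d)
  (P0 : probability T0 R) (P : probability T R)
  (W0 : {mfun T0 >-> b.-tuple (measurableTypeR R)})
  (W : seq 'I_b -> {mfun T >-> b.-tuple (measurableTypeR R)}).
Hypothesis W_law : forall (w : seq 'I_b) (B : set (b.-tuple (measurableTypeR R))),
  measurable B -> P (W w @^-1` B) = P0 (W0 @^-1` B).
Hypothesis W_indep : mutually_independent P W.
Hypothesis J_full : Jset P0 W0 = setT.
Variable A : R.
Hypotheses (A1 : 1 < A)
  (W0A : {ae P0, forall x, forall k : 'I_b, A^-1 <= (tnth (W0 x) k : R) <= A}).

Definition normalized_weight (q : R) (x : T) (u : seq 'I_b) (i : 'I_b) : R :=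
  (tnth (W u x) i : R) `^ q / phi P0 W0 q.

Let V := normalized_weight.

Lemma ae_weights (B : 'I_b -> set R) : (forall k, measurable (B k)) ->
  {ae P0, forall x, forall k, B k (tnth (W0 x) k)} ->
  {ae P, forall x, forall u k, B k (tnth (W u x) k)}.
Proof.
move=> mB h; apply: ae_forall_countable => u; apply: ae_forall_countable => k.
pose C := [set y : b.-tuple (measurableTypeR R) | ~ B k (tnth y k)].
have mC : measurable C.
  have := @measurable_tnth _ (measurableTypeR R) b k measurableT _ (measurableC (mB k)).
  by rewrite setTI.
have mW0C : measurable (W0 @^-1` C).
  by rewrite -[X in measurable X]setTI; exact: measurable_funP.
have mWC : measurable (W u @^-1` C).
  by rewrite -[X in measurable X]setTI; exact: measurable_funP.
apply: (@negligibleS _ _ _ _ (W u @^-1` C)) => //.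
suff PC : P (W u @^-1` C) = 0%E by apply/negligibleP.
rewrite W_law//; apply: measure_negligible => //.
by apply: negligibleS h => x /= nB /(_ k).
Qed.

Lemma ae_W_bounded : {ae P, forall x, forall u k, A^-1 <= (tnth (W u x) k : R) <= A}.
Proof.
apply: (@ae_weights (fun=> [set y | A^-1 <= y <= A])) => // k.
have -> : [set y : R | A^-1 <= y <= A] = `[A^-1, A]%classic.
  by apply/seteqP; split => y /=; rewrite in_itv.
exact: measurable_itv.
Qed.

Lemma ae_normalized_weight_le q r :
  {ae P0, forall x, forall k : 'I_b, (tnth (W0 x) k : R) `^ q / phi P0 W0 q <= r} ->
  {ae P, forall x, forall u k, V q x u k <= r}.
Proof.
apply: (@ae_weights (fun=> [set y | y `^ q / phi P0 W0 q <= r])) => k.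
rewrite -[X in measurable X]setTI; apply: measurable_fun_le => //.
by apply: measurable_funM => //; exact: measurable_powR.
Qed.

Section bounded_path.
Variables (x : T) (Q : R).
Hypothesis xA : forall u k, A^-1 <= (tnth (W u x) k : R) <= A.

Let phi_gt0 q : 0 < phi P0 W0 q := phi_gt0 hb A1 W0A q.

Let bR0 : 0 < b%:R :> R. Proof. by rewrite ltr0n ltnW. Qed.
Let lA0 : 0 <= ln A. Proof. by rewrite ln_ge0// ltW. Qed.

(** The numerator and phi(q) / b both lie between exp(- Q ln A) and exp(Q ln A), hence the factor
    2. *)
Lemma normalized_weight_bounds q : - Q <= q <= Q -> forall u i,
  expR (- (2 * Q * ln A)) / b%:R <= V q x u i <= expR (2 * Q * ln A) / b%:R.
Proof.
move=> qQ u i; have absq : `|q| <= Q by rewrite ler_norml.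
have p1 := powR_le_scale q 0 A1 (xA u i).
have p2 := powR_le_scale 0 q A1 (xA u i).
rewrite subr0 powRr0 mulr1 in p1; rewrite sub0r normrN powRr0 in p2.
have /andP[f1 f2] := phi_bounds A1 W0A q.
rewrite /V /normalized_weight; set X := _ `^ q in p1 p2 *.
have lq : ln A * `|q| <= Q * ln A by rewrite mulrC ler_wpM2r.
have X1 : expR (- (Q * ln A)) <= X.
  rewrite expRN -[leLHS]mul1r ler_pdivrMr ?expR_gt0//.
  apply: (le_trans p2); rewrite mulrC ler_wpM2l ?ler_expR//.
  exact: powR_ge0.
have X2 : X <= expR (Q * ln A) by apply: (le_trans p1); rewrite ler_expR.
have f2' : phi P0 W0 q <= b%:R * expR (Q * ln A).
  by apply: (le_trans f2); rewrite ler_wpM2l ?ler_expR// ltW.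
have f1' : b%:R * expR (- (Q * ln A)) <= phi P0 W0 q.
  by apply: le_trans f1; rewrite ler_wpM2l ?ler_expR ?lerN2// ltW.
have e2 : 2 * Q * ln A = Q * ln A + Q * ln A by ring.
apply/andP; split.
  have -> : expR (- (2 * Q * ln A)) / b%:R =
      expR (- (Q * ln A)) * (b%:R * expR (Q * ln A))^-1.
    by rewrite invfM -expRN mulrCA mulrC -expRD e2 opprD.
  apply: ler_pM => //; rewrite ?expR_ge0// ?invr_ge0 ?mulr_ge0 ?expR_ge0//.
  by rewrite lef_pV2 ?posrE ?mulr_gt0 ?expR_gt0.
have -> : expR (2 * Q * ln A) / b%:R =
    expR (Q * ln A) * (b%:R * expR (- (Q * ln A)))^-1.
  by rewrite invfM -expRN opprK mulrCA mulrC -expRD e2.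
apply: ler_pM => //; rewrite ?powR_ge0 ?invr_ge0 ?(ltW (phi_gt0 _))//.
by rewrite lef_pV2 ?posrE ?mulr_gt0 ?expR_gt0.
Qed.

Lemma normalized_weight_lip q q' u i :
  V q x u i <= expR (2 * ln A * `|q - q'|) * V q' x u i.
Proof.
have p1 := powR_le_scale q q' A1 (xA u i).
have p2 := phi_le_scale A1 W0A q' q; rewrite distrC in p2.
rewrite /V /normalized_weight mulrA ler_pdivlMr// mulrAC ler_pdivrMr//.
have -> : expR (2 * ln A * `|q - q'|) =
    expR (ln A * `|q - q'|) * expR (ln A * `|q - q'|).
  by rewrite -expRD; congr expR; ring.
apply: (le_trans (ler_pM _ _ p1 p2)); rewrite ?powR_ge0 ?(ltW (phi_gt0 _))//.
by rewrite le_eqVlt; apply/orP; left; apply/eqP; ring.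
Qed.

End bounded_path.

(** The weights are bounded by [r] only almost surely, whereas the exponential estimate takes a
    bound valid at every point. Clipping provides it and changes the weights on a null set only. *)
Definition clipped_weight (q r : R) (i : 'I_b) (y : b.-tuple (measurableTypeR R)) : R :=
  Num.min ((tnth y i : R) `^ q / phi P0 W0 q) r.

Lemma measurable_clipped_weight q r i : measurable_fun setT (clipped_weight q r i).
Proof.
apply: measurable_minr => //; apply: measurable_funM => //.
exact: measurable_tnth_powR.
Qed.

Lemma clipped_weight_itv q r i y : 0 <= r -> 0 <= clipped_weight q r i y <= r.
Proof.
move=> r0; rewrite /clipped_weight le_min r0 ge_min lexx orbT !andbT.
by rewrite divr_ge0 ?powR_ge0// ltW// (phi_gt0 hb A1 W0A).
Qed.

Lemma clipped_weight_mean q r u : 0 <= r ->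
  {ae P0, forall x, forall k : 'I_b, (tnth (W0 x) k : R) `^ q / phi P0 W0 q <= r} ->
  (\int[distribution P (W u)]_y (\sum_(i < b) clipped_weight q r i y)%:E = 1)%E.
Proof.
move=> r0 h.
have mS : measurable_fun setT (fun y => (\sum_(i < b) clipped_weight q r i y)%:E).
  apply/measurable_EFinP; apply: measurable_sum => i.
  exact: measurable_clipped_weight.
have S0 y : (0 <= (\sum_(i < b) clipped_weight q r i y)%:E)%E.
  by rewrite lee_fin sumr_ge0// => i _; have /andP[] := clipped_weight_itv q i y r0.
transitivity (\int[distribution P0 W0]_y (\sum_(i < b) clipped_weight q r i y)%:E)%E.
  by apply: eq_measure_integral => B mB _; exact: W_law.
rewrite ge0_integral_distribution//=.
have pq := phi_gt0 hb A1 W0A q.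
transitivity (\int[P0]_x ((phi P0 W0 q)^-1%:E * (moment_sum W0 q x)%:E))%E.
  apply: ae_eq_integral => //.
  - exact: (measurableT_comp mS).
  - apply/measurable_EFinP; apply: measurable_funM => //.
    exact: measurable_moment_sum.
  - move: h; apply: filterS => x hx _ /=.
    rewrite -EFinM mulrC /moment_sum mulr_suml; congr EFin.
    by apply: eq_bigr => i _; apply/min_idPl.
rewrite ge0_integralZl_EFin ?invr_ge0 ?(ltW pq)//; first last.
- by apply/measurable_EFinP; exact: measurable_moment_sum.
- by move=> x _; rewrite lee_fin moment_sum_ge0.
by rewrite (phiE A1 W0A) -EFinM mulVf// gt_eqF.
Qed.

Let clipped (q r : R) (x : T) u i := clipped_weight q r i (W u x).

Lemma clipped_step_tail q r rho e0 j n (w : seq 'I_b) : 0 < r <= 1 ->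
  {ae P0, forall x, forall k : 'I_b, (tnth (W0 x) k : R) `^ q / phi P0 W0 q <= r} ->
  0 < rho < 1 -> r <= rho ^+ 4 -> 0 < e0 <= 1 ->
  let c := e0 ^+ 2 / (64 * b%:R ^+ 2) in
  let F k x := flat_wt (clipped q r x) (flat_depth j) k w in
  measurable [set x | e0 * rho ^+ n <= `|F n.+1 x - F n x| /\ F n x <= 8] /\
  (P [set x | e0 * rho ^+ n <= `|F n.+1 x - F n x| /\ F n x <= 8]%R <=
   (2 * (expR (- (c * j%:R ^+ 2)) *
         expR (- (c * (rho^-1 - 1) ^+ 2 * n%:R ^+ 2))))%:E)%E.
Proof.
move=> r01 hr rho01 rrho e001 c F.
have /andP[r0 r1] := r01; have /andP[rho0 rho1] := rho01; have /andP[e00 e01] := e001.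
have b0 : (0 < b)%N by rewrite ltnW.
have b1 : 1 <= b%:R :> R by rewrite ler1n.
have mc i := measurable_clipped_weight q r i.
have ci i y := clipped_weight_itv q i y (ltW r0).
split.
  have mF k : measurable_fun setT (F k).
    exact: (measurable_flat_wt W mc).
  apply: measurableI; rewrite -[X in measurable X]setTI; apply: measurable_fun_le => //.
  by apply: measurableT_comp => //; apply: measurable_funB.
have rhon : rho ^+ n <= 1 by rewrite exprn_ile1// ltW.
have erho : 0 < e0 * rho ^+ n <= 16 * b%:R.
  rewrite mulr_gt0 ?exprn_gt0//=; apply: (@le_trans _ _ 1); last by lra.
  by rewrite -[leRHS]mulr1 ler_pM ?exprn_ge0 ?(ltW rho0) ?(ltW e00).
have := flat_step_tail W_indep b0 r01 mc ci
  (fun u => clipped_weight_mean u (ltW r0) hr) (flat_depth j) n w erho.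
move=> /le_trans; apply; rewrite lee_fin ler_pM2l// -expRD ler_expR -opprD lerN2.
have c0 : 0 < c by rewrite divr_gt0 ?mulr_gt0 ?exprn_gt0 ?(lt_le_trans ltr01 b1).
apply: (le_trans (step_exponent_ge j n hb r0 rho01 rrho c0)).
rewrite /c le_eqVlt; apply/orP; left; apply/eqP.
set B := b%:R ^- flat_depth j; set rn := r ^+ n.
have B0 : 0 < B by rewrite invr_gt0 exprn_gt0// (lt_le_trans ltr01 b1).
have rn0 : 0 < rn by rewrite exprn_gt0.
field; rewrite !lt0r_neq0// (lt_le_trans ltr01 b1)//.
Qed.

End cascade_bound.

Section cascade_log_bound.
Context (R : realType) (b : nat) (hb : (1 < b)%N)
  (d0 d : measure_display) (T0 : measurableType d0) (T : measurableType d)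
  (P0 : probability T0 R) (P : probability T R)
  (W0 : {mfun T0 >-> b.-tuple (measurableTypeR R)})
  (W : seq 'I_b -> {mfun T >-> b.-tuple (measurableTypeR R)}).
Hypothesis W_law : forall (w : seq 'I_b) (B : set (b.-tuple (measurableTypeR R))),
  measurable B -> P (W w @^-1` B) = P0 (W0 @^-1` B).
Hypothesis W_indep : mutually_independent P W.
Hypothesis J_full : Jset P0 W0 = setT.
Variable A : R.
Hypotheses (A1 : 1 < A)
  (W0A : {ae P0, forall x, forall k : 'I_b, A^-1 <= (tnth (W0 x) k : R) <= A}).

Local Notation V := (normalized_weight P0 W0 W).

(** A union bound over the b^j words and the N0 4^n grid points; the Gaussian factors in [j] and in
    [n] absorb these numbers and leave a summable double series for the Borel-Cantelli lemma. *)
Lemma grid_steps_eventually_small (Q r rho e0 : R) (N0 : nat) : 0 < Q ->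
  0 < r <= 1 ->
  (forall q, - Q <= q <= Q ->
    {ae P0, forall x, forall k : 'I_b, (tnth (W0 x) k : R) `^ q / phi P0 W0 q <= r}) ->
  0 < rho < 1 -> r <= rho ^+ 4 -> 0 < e0 <= 1 ->
  {ae P, forall x, \forall j \near \oo, forall w, size w = j ->
    forall n k, (k < N0 * 4 ^ n)%N ->
    let F m := flat_wt (V (grid Q N0 n k) x) (flat_depth j) m w in
    F n <= 8 -> `|F n.+1 - F n| <= e0 * rho ^+ n}.
Proof.
move=> Q0 r01 hr rho01 rrho e001.
have /andP[r0 r1] := r01; have /andP[rho0 rho1] := rho01; have /andP[e00 e01] := e001.
pose F q j w n x :=
  flat_wt (fun u i => clipped_weight P0 W0 q r i (W u x)) (flat_depth j) n w.
pose S0 q j w n := [set x | e0 * rho ^+ n <= `|F q j w n.+1 x - F q j w n x| /\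
  F q j w n x <= 8].
pose c := e0 ^+ 2 / (64 * b%:R ^+ 2).
have bR0 : 0 < b%:R :> R by rewrite ltr0n ltnW.
have c0 : 0 < c by rewrite divr_gt0 ?mulr_gt0 ?exprn_gt0.
have S0P q j w n : - Q <= q <= Q -> measurable (S0 q j w n) /\
  (P (S0 q j w n) <= (2 * (expR (- (c * j%:R ^+ 2)) *
         expR (- (c * (rho^-1 - 1) ^+ 2 * n%:R ^+ 2))))%:E)%E.
  move=> qQ; exact: (clipped_step_tail hb W_law W_indep A1 W0A j n w r01
    (hr q qQ) rho01 rrho e001).
pose S j n := \big[setU/set0]_(k <- enum 'I_(N0 * 4 ^ n))
  \big[setU/set0]_(w <- enum {: j.-tuple 'I_b}) S0 (grid Q N0 n k) j w n.
have t0 : 0 < rho^-1 - 1 by rewrite subr_gt0 invf_gt1.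
have c2 : 0 < c * (rho^-1 - 1) ^+ 2 by rewrite mulr_gt0 ?exprn_gt0.
have [C1 C10 hC1] := gaussian_beats_geometric bR0 c0.
have four0 : 0 < 4 :> R by [].
have [C2 C20 hC2] := gaussian_beats_geometric four0 c2.
have mSS j n (k : 'I_(N0 * 4 ^ n)) : measurable
    (\big[setU/set0]_(w <- enum {: j.-tuple 'I_b}) S0 (grid Q N0 n k) j w n).
  by apply: bigsetU_measurable => w _; apply: (S0P _ _ _ _ _).1; exact: grid_itv.
have mS j n : measurable (S j n).
  by apply: bigsetU_measurable => k _; exact: mSS.
have PS j n : (P (S j n) <= ((2 * N0%:R * C1 * C2) / 2 ^+ j.+1 / 2 ^+ n.+1)%:E)%E.
  set p := 2 * (expR (- (c * j%:R ^+ 2)) * expR (- (c * (rho^-1 - 1) ^+ 2 * n%:R ^+ 2))).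
  have h1 : (P (S j n) <= ((size (enum 'I_(N0 * 4 ^ n)))%:R *
     ((size (enum {: j.-tuple 'I_b}))%:R * p))%:E)%E.
    apply: measure_bigsetU_le => // k; apply: measure_bigsetU_le => w.
      by apply: (S0P _ _ _ _ _).1; exact: grid_itv.
    by apply: (S0P _ _ _ _ _).2; exact: grid_itv.
  apply: (le_trans h1); rewrite -!cardE card_ord card_tuple card_ord lee_fin.
  have g1 := hC1 j; have g2 := hC2 n.
  have -> : (N0 * 4 ^ n)%:R * ((b ^ j)%:R * p) = 2 * N0%:R *
    ((b%:R ^+ j * expR (- (c * j%:R ^+ 2))) *
     (4 ^+ n * expR (- (c * (rho^-1 - 1) ^+ 2 * n%:R ^+ 2)))).
    by rewrite /p natrM !natrX; ring.
  have -> : 2 * N0%:R * C1 * C2 / 2 ^+ j.+1 / 2 ^+ n.+1 = 2 * N0%:R *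
    ((C1 / 2 ^+ j.+1) * (C2 / 2 ^+ n.+1)).
    by rewrite -!mulrA; congr (_ * (_ * (_ * _))); rewrite mulrCA.
  rewrite ler_wpM2l ?mulr_ge0//.
  by apply: ler_pM; rewrite ?mulr_ge0 ?exprn_ge0 ?expR_ge0// ltW.
have C0 : 0 <= 2 * N0%:R * C1 * C2 by rewrite !mulr_ge0// ltW.
(* The grids contain countably many parameters, so a single null set suffices to undo the clipping
   at all of them. *)
have Vr : {ae P, forall x, forall nk : nat * nat, (nk.2 < N0 * 4 ^ nk.1)%N ->
    forall u i, V (grid Q N0 nk.1 nk.2) x u i <= r}.
  apply: ae_forall_countable => -[n k] /=.
  have [kN|] := boolP (k < N0 * 4 ^ n)%N; last by move=> _; apply: aeW.
  have := ae_normalized_weight_le W_law (hr _ (grid_itv Q0 kN)).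
  by apply: filterS => x h _.
have BC := borel_cantelli_double C0 mS PS.
apply: filterS2 BC Vr => x BCx Vrx.
apply: filterS BCx => j nS w wj n k kN /= F8.
have FE n' : flat_wt (V (grid Q N0 n k) x) (flat_depth j) n' w =
    F (grid Q N0 n k) j w n' x.
  rewrite /F /flat_wt; congr (_ * _); apply: eq_bigr => u _; apply: eq_bigr => v _.
  apply: eq_wt => z i; rewrite /clipped_weight; apply/esym/min_idPl.
  exact: (Vrx (n, k)).
rewrite !FE in F8 *.
rewrite leNgt; apply/negP => big; apply: (nS n).
apply: (@in_bigsetU _ _ _ _ (Ordinal kN)); first by rewrite mem_enum.
apply: (@in_bigsetU _ _ _ _ (Tuple (introT eqP wj))); first by rewrite mem_enum.
by split; [exact: ltW big|exact: F8].
Qed.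

Lemma cascade_log_bound (Q : R) : 0 < Q -> exists2 theta, 0 < theta &
  {ae P, forall x, \forall j \near \oo, forall w, size w = j ->
    forall q, - Q <= q < Q -> forall n,
    `|ln (total_wt (V q x) (flat_depth j + n) w)| <= theta * ln j%:R}.
Proof.
move=> Q0.
have [r r01 hr] := weight_sup hb A1 W0A J_full Q0.
have /andP[r0 r1] := r01.
have r01' : 0 < r <= 1 by rewrite r0 ltW.
(* By Bernoulli's inequality rho^4 >= 1 - (1 - r) = r, and rho > 3/4 meets the lower bound 1/2
   needed for the chaining. *)
pose rho := 1 - (1 - r) / 4.
have rhoE : 2^-1 <= rho < 1 by rewrite /rho; apply/andP; split; lra.
have rho01 : 0 < rho < 1 by rewrite /rho; apply/andP; split; lra.
have rrho : r <= rho ^+ 4.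
  rewrite -subr_ge0 /rho; set t := (1 - r) / 4.
  have -> : r = 1 - 4 * t by rewrite /t; lra.
  have -> : (1 - t) ^+ 4 - (1 - 4 * t) = t ^+ 2 * ((t - 2) ^+ 2 + 2) by ring.
  by rewrite mulr_ge0 ?sqr_ge0// addr_ge0 ?sqr_ge0.
pose e0 := (1 - rho) / 32.
have e001 : 0 < e0 <= 1 by rewrite /e0 /rho; apply/andP; split; lra.
have e0rho : 0 < e0 <= (1 - rho) / 32 by rewrite lexx andbT; case/andP: e001.
have lA0 : 0 < ln A by rewrite ln_gt0.
pose D := 2 * ln A; have D0 : 0 <= D by rewrite mulr_ge0// ltW.
pose N0 := (Num.truncn (8 * D * Q / (1 - rho))).+1.
have rho1 : 0 < 1 - rho by rewrite /rho; lra.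
have DQ : 4 * D * Q / N0%:R <= (1 - rho) / 2.
  have := truncnS_gt (8 * D * Q / (1 - rho)).
  rewrite -/N0 ltr_pdivrMr// ler_pdivrMr ?ltr0n// => h.
  by move: h; set DR := D; set rhoR := rho; set NR := N0%:R; lra.
pose kappa := 2 * Q * ln A.
have kappa0 : 0 < kappa by rewrite !mulr_gt0.
have ln2 : 0 < ln 2 :> R by rewrite ln_gt0// ltr1n.
(* The first term pays for the flattened generations through [flat_depth_le], the second for the
   additive 1 of [total_wt_bound], as ln j >= ln 2. *)
exists (kappa * (4 / ln 2) + (ln 2)^-1).
  by rewrite addr_gt0 ?invr_gt0// mulr_gt0// divr_gt0.
have := grid_steps_eventually_small N0 Q0 r01' hr rho01 rrho e001.
apply: filterS2 (ae_W_bounded W_law W0A) => x xA hx.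
apply: filterS2 hx (nbhs_infty_gt 1) => j hj j1 w wj q qQ n.
apply: (@le_trans _ _ (kappa * (flat_depth j)%:R + 1)).
  apply: (@total_wt_bound R b (ltnW hb) (fun q => V q x) kappa D Q rho e0 N0) => //.
  - exact: normalized_weight_bounds.
  - by move=> q1 q2 _ _ u i; exact: normalized_weight_lip.
  - by move=> n' k kN; exact: hj.
rewrite mulrDl; apply: lerD.
  by rewrite -(mulrA kappa) ler_pM2l//; exact: flat_depth_le.
rewrite ler_pdivlMl// mulr1 ler_ln ?posrE ?ltr0n ?(ltnW j1)//.
by rewrite ler_nat.
Qed.

End cascade_log_bound.

(** * Weak limits and masses of b-adic intervals *)

Section badic_cells.
Context (R : realType) (b : nat) (hb : (1 < b)%N).
Implicit Types (u v w : seq 'I_b) (i : 'I_b) (t : R).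

Let b0 : (0 < b)%N := ltnW hb.
Let bR0 : 0 < b%:R :> R. Proof. by rewrite ltr0n. Qed.
Let bn0 n : 0 < b%:R ^+ n :> R. Proof. by rewrite exprn_gt0. Qed.

Lemma word_indexE w : word_index w =
  (\sum_(k < size w) nth 0 (map val w) k * b ^ (size w - k.+1))%N.
Proof.
apply: eq_bigr => k _.
by rewrite (tnth_nth (Ordinal b0)) (nth_map (Ordinal b0))//= ltn_ord.
Qed.

Lemma word_index_rcons w i : word_index (rcons w i) = (b * word_index w + i)%N.
Proof.
rewrite !word_indexE size_rcons big_ord_recr /= subnn muln1 map_rcons.
rewrite nth_rcons size_map ltnn eqxx; congr addn.
rewrite big_distrr /=; apply: eq_bigr => k _.
by rewrite nth_rcons size_map ltn_ord subSn// expnS mulnCA.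
Qed.

Lemma word_index0 : word_index ([::] : seq 'I_b) = 0%N.
Proof. by rewrite word_indexE big_ord0. Qed.

Lemma word_index_lt w : (word_index w < b ^ size w)%N.
Proof.
elim/last_ind: w => [|w i IHw]; first by rewrite word_index0.
rewrite word_index_rcons size_rcons expnS.
apply: (@leq_trans (b * (word_index w).+1)); last by rewrite leq_pmul2l.
by rewrite mulnS addnC ltn_add2r.
Qed.

Lemma word_index_inj u v : size u = size v -> word_index u = word_index v -> u = v.
Proof.
elim/last_ind: u v => [|u i IHu] v; elim/last_ind: v => [|v j _] //;
  rewrite ?size_rcons// => -[suv]; rewrite !word_index_rcons => h.
have ij : (i : nat) = j.
  have := congr1 (modn^~ b) h.
  by rewrite ![(b * _)%N]mulnC !modnMDl !modn_small.
rewrite (val_inj ij); congr rcons; apply: IHu => //.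
move: h; rewrite ij => /addIn /eqP; rewrite eqn_pmul2l// => /eqP //.
Qed.

Lemma word_index_cat_nseq0 v p :
  word_index (v ++ nseq p (Ordinal b0)) = (word_index v * b ^ p)%N.
Proof.
elim: p => [|p IHp]; first by rewrite cats0 muln1.
by rewrite -(addn1 p) nseqD catA cats1 word_index_rcons IHp addn0 addn1 expnS mulnCA.
Qed.

Lemma ltn_predb : (b.-1 < b)%N. Proof. by rewrite prednK. Qed.

Lemma word_index_cat_nseq_max v p :
  (word_index (v ++ nseq p (Ordinal ltn_predb))).+1 = ((word_index v).+1 * b ^ p)%N.
Proof.
elim: p => [|p IHp]; first by rewrite cats0 muln1.
rewrite -(addn1 p) nseqD catA cats1 word_index_rcons addn1 expnS mulnCA -IHp /=.
by rewrite -addnS prednK// mulnS addnC.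
Qed.

Definition left_end v : R := (word_index v)%:R / b%:R ^+ size v.
Definition right_end v : R := (word_index v).+1%:R / b%:R ^+ size v.
(** Half-open, so that the cells of one generation partition [0, 1[ and each is the set of points
    with a given prefix. *)
Definition cell v : set R := `[left_end v, right_end v[%classic.

Lemma right_endE v : right_end v = left_end v + b%:R ^- size v.
Proof. by rewrite /right_end -natr1 mulrDl mul1r. Qed.

Lemma cellE v t : 0 <= t -> cell v t <-> Num.truncn (t * b%:R ^+ size v) = word_index v.
Proof.
move=> t0; have tb0 : 0 <= t * b%:R ^+ size v by rewrite mulr_ge0// ltW.
rewrite /cell /= in_itv /= /left_end /right_end ler_pdivrMr// ltr_pdivlMr//.
split=> [h|/eqP]; first by apply/eqP; rewrite truncn_eq.
by rewrite truncn_eq.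
Qed.

Lemma cell_itv v t : cell v t -> 0 <= t < 1.
Proof.
rewrite /cell /= in_itv /= => /andP[h1 h2]; apply/andP; split.
  by apply: le_trans h1; rewrite divr_ge0// ltW.
apply: (lt_le_trans h2); rewrite ler_pdivrMr// mul1r -natrX ler_nat.
exact: word_index_lt.
Qed.

Lemma truncn_div (y : R) : 0 <= y -> (Num.truncn (y * b%:R) %/ b)%N = Num.truncn y.
Proof.
move=> y0; have yb0 : 0 <= y * b%:R by rewrite mulr_ge0// ltW.
have /andP[h1 h2] := truncn_itv yb0; set m := Num.truncn (y * b%:R) in h1 h2 *.
apply/esym/eqP; rewrite truncn_eq//; apply/andP; split.
  rewrite -(ler_pM2r bR0) -natrM; apply: le_trans h1.
  by rewrite ler_nat leq_trunc_div.
rewrite -(ltr_pM2r bR0) -natrM; apply: (lt_le_trans h2).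
by rewrite ler_nat ltn_ceil.
Qed.

Lemma prefixS t n : prefix_of hb t n.+1 = rcons (prefix_of hb t n) (digit hb t n).
Proof. exact: mkseqS. Qed.

Lemma word_index_prefix t n : 0 <= t < 1 ->
  word_index (prefix_of hb t n) = Num.truncn (t * b%:R ^+ n).
Proof.
move=> /andP[t0 t1]; elim: n => [|n IHn].
  rewrite word_index0 expr0 mulr1; apply/esym/eqP.
  by rewrite truncn_eq// t0.
rewrite prefixS word_index_rcons IHn.
have -> : Num.truncn (t * b%:R ^+ n) = (Num.truncn (t * b%:R ^+ n.+1) %/ b)%N.
  by rewrite exprSr mulrA truncn_div// mulr_ge0// ltW.
by rewrite mulnC /= -divn_eq.
Qed.

Lemma size_prefix t n : size (prefix_of hb t n) = n.
Proof. by rewrite size_mkseq. Qed.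

Lemma cell_prefix t n : 0 <= t < 1 -> cell (prefix_of hb t n) t.
Proof.
move=> h; have /andP[t0 _] := h.
by apply/(cellE _ t0); rewrite word_index_prefix// size_prefix.
Qed.

Lemma prefix_cell v t : cell v t -> prefix_of hb t (size v) = v.
Proof.
move=> vt; have h := cell_itv vt; have /andP[t0 _] := h.
apply: word_index_inj; first by rewrite size_prefix.
by rewrite word_index_prefix//; apply/(cellE _ t0).
Qed.

Lemma prefix_take t m n : (m <= n)%N -> take m (prefix_of hb t n) = prefix_of hb t m.
Proof. by move=> mn; rewrite /prefix_of /mkseq -map_take take_iota (minn_idPl mn). Qed.

Lemma cell_bigsetU v : cell v = \big[setU/set0]_(i <- enum 'I_b) cell (rcons v i).
Proof.
apply/seteqP; split => t.
  move=> vt; have h := cell_itv vt.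
  apply: (@in_bigsetU _ _ _ _ (digit hb t (size v))); first by rewrite mem_enum.
  have := cell_prefix (size v).+1 h.
  by rewrite prefixS prefix_cell.
move=> vt; have [i it] : exists i, cell (rcons v i) t.
  elim: (enum _) vt => [|i s IHs]; first by rewrite big_nil.
  by rewrite big_cons => -[it|/IHs//]; exists i.
have h := cell_itv it; have := prefix_cell it; rewrite size_rcons => pv.
have := cell_prefix (size v) h.
rewrite -(prefix_take t (leqnSn (size v))) pv -cats1 take_size_cat//.
Qed.

Lemma cell_rcons_trivIset v (s : seq 'I_b) :
  trivIset [set` s] (fun i => cell (rcons v i)).
Proof.
move=> i j _ _ [t [/prefix_cell hi /prefix_cell hj]].
by move: hi hj; rewrite !size_rcons => -> /rcons_inj[].
Qed.

Lemma measurable_cell v : measurable (cell v : set (measurableTypeR R)).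
Proof. exact: measurable_itv. Qed.

Lemma cell_nil : cell [::] = `[0%R, 1%R[%classic.
Proof. by rewrite /cell /left_end /right_end word_index0 expr0 !divr1. Qed.

Lemma lebesgue_measure_cell v :
  @lebesgue_measure R (cell v) = (b%:R ^- size v)%:E.
Proof.
rewrite /cell lebesgue_measure_itv /= lte_fin right_endE.
by rewrite ltrDl invr_gt0 bn0 -EFinD addrAC subrr add0r.
Qed.

Variable V : seq 'I_b -> 'I_b -> R.
Hypothesis V0 : forall u i, 0 <= V u i.

Lemma wt_ge0 w v : 0 <= wt V w v.
Proof. by elim: v w => //= i v IHv w; rewrite mulr_ge0. Qed.

Lemma cascade_densityE w n t :
  cascade_density hb V w n t = b%:R ^+ n * wt V w (prefix_of hb t n).
Proof.
rewrite /cascade_density; congr (_ * _); elim: n => [|n IHn]; first by rewrite big_ord0.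
by rewrite big_ord_recr IHn prefixS wt_rcons.
Qed.

Lemma cascade_density_ge0 w n t : 0 <= cascade_density hb V w n t.
Proof. by rewrite cascade_densityE mulr_ge0 ?wt_ge0// ltW. Qed.

Lemma measurable_cascade_density w n :
  measurable_fun (`[0%R, 1%R[ : set (measurableTypeR R)) (cascade_density hb V w n).
Proof.
pose g t := \sum_(v : n.-tuple 'I_b) b%:R ^+ n * wt V w v * \1_(cell v) t.
apply: (@eq_measurable_fun _ _ _ _ _ g).
  move=> t; rewrite inE /= in_itv /= => h.
  have sz : size (prefix_of hb t n) == n by rewrite size_prefix.
  rewrite /g cascade_densityE (bigD1 (Tuple sz))//= indicE mem_set ?mulr1;
    last exact: cell_prefix.
  rewrite big1 ?addr0// => v /eqP vp.
  rewrite indicE memNset ?mulr0// => /prefix_cell; rewrite size_tuple => pv.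
  by apply: vp; apply/val_inj.
apply: measurable_sum => v; apply: measurable_funM => //.
apply: measurable_indic; exact: measurable_cell.
Qed.

(** For [n = 0] the density is constant on the cell; the induction splits the cell into its [b]
    children. *)
Lemma integral_cell_density w v n :
  (\int[@lebesgue_measure R]_(t in cell v)
     (cascade_density hb V w (size v + n) t)%:E =
   (wt V w v * total_wt V n (w ++ v))%:E)%E.
Proof.
elim: n v => [|n IHn] v.
  rewrite addn0 total_wt0 mulr1.
  transitivity (\int[@lebesgue_measure R]_(t in cell v)
      (cst (b%:R ^+ size v * wt V w v)%:E) t)%E.
    apply: eq_integral => t; rewrite inE => vt.
    by rewrite cascade_densityE prefix_cell.
  rewrite integral_cst//; last exact: measurable_cell.
  rewrite [X in (_ * X)%E]lebesgue_measure_cell -EFinM; congr EFin.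
  by rewrite mulrAC divff ?mul1r// lt0r_neq0.
rewrite {1}cell_bigsetU ge0_integral_bigsetU//=; last 5 first.
- by move=> i; exact: measurable_cell.
- exact: enum_uniq.
- exact: cell_rcons_trivIset.
- apply/measurable_EFinP; rewrite -cell_bigsetU.
  apply: measurable_funS (measurable_cascade_density w _); first exact: measurable_itv.
  by move=> t /cell_itv; rewrite /= in_itv.
- by move=> t _; rewrite lee_fin cascade_density_ge0.
rewrite -(addn1 n) (addnC n 1) (total_wt_cat V 1 n).
rewrite (sum_1tuple (fun u => wt V (w ++ v) u * total_wt V n ((w ++ v) ++ u))).
rewrite mulr_sumr -sumEFin big_enum /=; apply: eq_bigr => i _.
have -> : (size v + (1 + n))%N = (size (rcons v i) + n)%N.
  by rewrite size_rcons addnA addn1.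
rewrite IHn wt_rcons mulr1 -cats1 catA mulrA.
by [].
Qed.

End badic_cells.

Lemma ge0_integral_setU_le (d : measure_display) (T : measurableType d)
    (R : realType) (mu : {measure set T -> \bar R}) (C D : set T) (f : T -> \bar R) :
  measurable C -> measurable D -> measurable_fun (C `|` D) f ->
  (forall x, (C `|` D) x -> (0 <= f x)%E) ->
  (\int[mu]_(x in C `|` D) f x <= \int[mu]_(x in C) f x + \int[mu]_(x in D) f x)%E.
Proof.
move=> mC mD mf f0.
have CDE : C `|` D = C `|` (D `\` C).
  apply/seteqP; split => x; last by case=> [|[]]; [left|right].
  by have [?|nCx [//|Dx]] := pselect (C x); [left|right].
have mDC : measurable (D `\` C) by exact: measurableD.
rewrite {1}CDE ge0_integral_setU//; last 3 first.
- by rewrite -CDE.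
- by move=> x; rewrite -CDE; exact: f0.
- by rewrite disj_set2E; apply/eqP; rewrite setDIK.
rewrite leeD2l//; apply: ge0_subset_integral => //.
- by apply: measurable_funS mf; [exact: measurableU|move=> x; right].
- by move=> x Dx; apply: f0; right.
Qed.

Section weak_limit_cells.
Context (R : realType) (b : nat) (hb : (1 < b)%N).
Variables (V : seq 'I_b -> 'I_b -> R)
  (m : seq 'I_b -> {finite_measure set (measurableTypeR R) -> \bar R}).
Hypothesis V0 : forall u i, 0 <= V u i.
Hypothesis mlim : forall w, weak_limit (cascade_density hb V w) (m w).

Let b0 : (0 < b)%N := ltnW hb.
Let bR0 : 0 < b%:R :> R. Proof. by rewrite ltr0n. Qed.
Let M w : R := fine (mass (m w)).

Lemma mass_fin w : mass (m w) = (M w)%:E.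
Proof. by rewrite /M fineK// fin_num_measure. Qed.

Let Icc_cvg w (f : R -> R) : {within `[0%R, 1%R], continuous f} ->
  (\int[@lebesgue_measure R]_(t in `[0%R, 1%R]) (f t * cascade_density hb V w j t)%:E)%E
    @[j --> \oo] --> (\int[m w]_(t in `[0%R, 1%R]) (f t)%:E)%E.
Proof. exact: mlim. Qed.

Let measurable_density_Icc w n :
  measurable_fun (`[0%R, 1%R] : set (measurableTypeR R)) (cascade_density hb V w n).
Proof.
by apply/measurable_fun_itv_bndo_bndcP; exact: measurable_cascade_density.
Qed.

(** The weak limit is tested against the constant function 1. *)
Lemma total_wt_cvg w : total_wt V n w @[n --> \oo] --> M w.
Proof.
have h : (total_wt V n w)%:E @[n --> \oo] --> (M w)%:E.
  have c1 : {within `[0%R, 1%R], continuous (cst 1 : R -> R)}.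
    by apply: continuous_subspaceT => ?; exact: cvg_cst.
  have := @Icc_cvg w _ c1.
  rewrite [X in _ --> X -> _](_ : _ = (M w)%:E); last first.
    by rewrite (integral_cst _ _ 1%:E)// mul1e -mass_fin.
  rewrite [X in X @ _ --> _ -> _](_ : _ = fun n => (total_wt V n w)%:E)//.
  apply/funext => n.
  under eq_integral do rewrite mul1r.
  rewrite -integral_itv_bndo_bndc; last first.
    by apply/measurable_EFinP; exact: measurable_cascade_density.
  rewrite -(cell_nil R hb).
  by have := integral_cell_density hb V0 w [::] n; rewrite /= mul1r cats0.
by have /fine_cvgP[_] := h.
Qed.

Lemma mass_cat w n :
  M w = \sum_(v : n.-tuple 'I_b) wt V w v * M (w ++ v).
Proof.
have h1 : total_wt V (n + k) w @[k --> \oo] --> M w.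
  exact: (cvg_comp (addn n) (fun k => total_wt V k w) (@cvg_addnl n)
    (total_wt_cvg (w := w))).
have h2 : total_wt V (n + k) w @[k --> \oo] -->
    \sum_(v : n.-tuple 'I_b) wt V w v * M (w ++ v).
  under eq_fun do rewrite total_wt_cat.
  apply: cvg_big => [|v _]; first exact: add_continuous.
  apply: cvgM; first exact: cvg_cst.
  exact: total_wt_cvg.
exact: (cvg_unique _ h1 h2).
Qed.

(** A continuous trapezoid supported by [alpha, beta], with ramps of width [h] at both ends. *)
Definition bump (alpha beta h t : R) : R :=
  Num.min 1 (Num.max 0 (Num.min ((t - alpha) / h) ((beta - t) / h))).

Lemma continuous_bump alpha beta h : continuous (bump alpha beta h).
Proof.
move=> t; pose f1 (x : R) : R := (x - alpha) / h; pose f2 (x : R) : R := (beta - x) / h.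
have cf1 : {for t, continuous f1}.
  by apply: cvgM; [apply: cvgB; [exact: cvg_id|exact: cvg_cst]|exact: cvg_cst].
have cf2 : {for t, continuous f2}.
  by apply: cvgM; [apply: cvgB; [exact: cvg_cst|exact: cvg_id]|exact: cvg_cst].
have cc (k : R) : {for t, continuous (cst k : R -> R)} by exact: cvg_cst.
exact: (continuous_min (cc 1) (continuous_max (cc 0) (continuous_min cf1 cf2))).
Qed.

Lemma bump_ge0 alpha beta h t : 0 <= bump alpha beta h t.
Proof. by rewrite /bump le_min ler01 le_max lexx. Qed.

Lemma bump_le_indic alpha beta h t : 0 < h ->
  bump alpha beta h t <= \1_(`]alpha, beta[%classic) t.
Proof.
move=> h0; rewrite indicE.
have [tin|tnin] := boolP (t \in `]alpha, beta[%classic).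
  by rewrite /bump ge_min lexx.
rewrite /bump ge_min ge_max lexx /=; apply/orP; right.
rewrite ge_min; move: tnin; rewrite notin_setE /= in_itv /= => /negP.
rewrite negb_and -!leNgt => /orP[ta|tb]; apply/orP; [left|right].
  by rewrite pmulr_lle0 ?invr_gt0// subr_le0.
by rewrite pmulr_lle0 ?invr_gt0// subr_le0.
Qed.

Lemma bump_eq1 alpha beta h t : 0 < h -> alpha + h <= t <= beta - h ->
  bump alpha beta h t = 1.
Proof.
move=> h0 /andP[h1 h2]; rewrite /bump; apply/min_idPl.
rewrite le_max; apply/orP; right; rewrite le_min !ler_pdivlMr// !mul1r.
by apply/andP; split; lra.
Qed.

(** The leftmost ([e = false]) or rightmost ([e = true]) descendant of [v], [p] generations down;
    its cell touches that end of the cell of [v]. *)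
Definition edge_word (v : seq 'I_b) (e : bool) (p : nat) : seq 'I_b :=
  v ++ nseq p (if e then Ordinal (ltn_predb hb) else Ordinal b0).

Let size_edge v e p : size (edge_word v e p) = (size v + p)%N.
Proof. by rewrite size_cat size_nseq. Qed.

(** The ramps of this bump are as wide as the two edge cells and lie over them. *)
Lemma cell_minus_edges v p t : @cell R b v t ->
  ~ @cell R b (edge_word v false p) t -> ~ @cell R b (edge_word v true p) t ->
  bump (left_end R v) (right_end R v) (b%:R ^- (size v + p)) t = 1.
Proof.
rewrite /cell /= !in_itv /= => /andP[h1 h2] n0 n1.
have h0 : 0 < b%:R ^- (size v + p) :> R by rewrite invr_gt0 exprn_gt0.
have pw n k : n%:R / b%:R ^+ k = (n * b ^ p)%N%:R / b%:R ^+ (k + p) :> R.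
  by rewrite exprD natrM natrX; field; rewrite !expf_neq0// lt0r_neq0.
have l0 : left_end R (edge_word v false p) = left_end R v.
  rewrite /left_end size_edge (pw (word_index v)).
  by rewrite /edge_word (word_index_cat_nseq0 hb).
have r1 : right_end R (edge_word v true p) = right_end R v.
  rewrite /right_end size_edge (pw (word_index v).+1).
  by rewrite /edge_word (word_index_cat_nseq_max hb).
have r0 := right_endE R (edge_word v false p).
have l1 := right_endE R (edge_word v true p).
rewrite !size_edge in r0 l1.
apply: bump_eq1 => //; apply/andP; split.
  rewrite leNgt; apply/negP => lt; apply: n0.
  by rewrite r0 l0 h1.
rewrite leNgt; apply/negP => lt; apply: n1; apply/andP; split; last by rewrite r1.
by rewrite r1 in l1; lra.
Qed.
(** The bump lies below the indicator of the open cell and equals 1 on the cell without its two edge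
    cells. Before the limit its integral is thus at least the weight of the cell minus those of the
    edges, and weak convergence carries this over. *)
Lemma open_cell_mass_ge_edges w v p :
  ((wt V w v * M (w ++ v) -
    (wt V w (edge_word v false p) * M (w ++ edge_word v false p) +
     wt V w (edge_word v true p) * M (w ++ edge_word v true p)))%:E <=
   m w `]left_end R v, right_end R v[%classic)%E.
Proof.
pose c e := @cell R b (edge_word v e p).
pose f := bump (left_end R v) (right_end R v) (b%:R ^- (size v + p)).
have h0 : 0 < b%:R ^- (size v + p) :> R by rewrite invr_gt0 exprn_gt0.
have cf : {within `[0%R, 1%R], continuous f}.
  by apply: continuous_subspaceT => ?; exact: continuous_bump.
have mf : measurable_fun setT (f : measurableTypeR R -> R).
  by apply: continuous_measurable_fun => ?; exact: continuous_bump.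
have mI : measurable (`[0%R, 1%R] : set (measurableTypeR R)) by exact: measurable_itv.
have mc z : measurable (@cell R b z : set (measurableTypeR R)) by exact: measurable_cell.
have cI z : @cell R b z `<=` `[0%R, 1%R].
  by move=> t /(cell_itv hb); rewrite /= in_itv /= => /andP[-> /ltW].
have step k : ((wt V w v * total_wt V (p + k) (w ++ v) -
    (wt V w (edge_word v false p) * total_wt V k (w ++ edge_word v false p) +
     wt V w (edge_word v true p) * total_wt V k (w ++ edge_word v true p)))%:E <=
  \int[@lebesgue_measure R]_(t in `[0%R, 1%R])
     (f t * cascade_density hb V w (size v + p + k) t)%:E)%E.
  set N := (size v + p + k)%N; pose g t := (cascade_density hb V w N t)%:E.
  have mgI : measurable_fun (`[0%R, 1%R] : set (measurableTypeR R)) g.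
    by apply/measurable_EFinP; exact: measurable_density_Icc.
  have g0 t : (0 <= g t)%E by rewrite lee_fin cascade_density_ge0.
  have fg0 t : (0 <= (f t * cascade_density hb V w N t)%:E)%E.
    by rewrite lee_fin mulr_ge0 ?bump_ge0// cascade_density_ge0.
  have mfgI : measurable_fun (`[0%R, 1%R] : set (measurableTypeR R))
      (fun t => (f t * cascade_density hb V w N t)%:E).
    apply/measurable_EFinP; apply: measurable_funM; first exact: measurable_funTS.
    exact: measurable_density_Icc.
  have gs (D : set R) : measurable (D : set (measurableTypeR R)) -> D `<=` `[0%R, 1%R] ->
      measurable_fun (D : set (measurableTypeR R)) g.
    by move=> mD DI; apply: measurable_funS mgI.
  have ic e : (\int[@lebesgue_measure R]_(t in c e) g t =
      (wt V w (edge_word v e p) * total_wt V k (w ++ edge_word v e p))%:E)%E.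
    rewrite /g /N -(size_edge v e p); exact: integral_cell_density.
  have iv : (\int[@lebesgue_measure R]_(t in @cell R b v) g t =
      (wt V w v * total_wt V (p + k) (w ++ v))%:E)%E.
    rewrite /g /N -addnA; exact: integral_cell_density.
  pose mid := @cell R b v `\` (c false `|` c true).
  have mcc : measurable (c false `|` c true : set (measurableTypeR R)).
    by apply: measurableU; exact: mc.
  have mmid : measurable (mid : set (measurableTypeR R)) by exact: measurableD.
  have midI : mid `<=` `[0%R, 1%R] by move=> t [/cI].
  have ccI : c false `|` c true `<=` `[0%R, 1%R] by move=> t [] /cI.
  have allI : mid `|` (c false `|` c true) `<=` `[0%R, 1%R] by move=> t [/midI|/ccI].
  have mall : measurable (mid `|` (c false `|` c true) : set (measurableTypeR R)).
    exact: measurableU.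
  rewrite EFinB leeBlDr// -iv EFinD -!ic.
  apply: (@le_trans _ _
    (\int[@lebesgue_measure R]_(t in mid `|` (c false `|` c true)) g t)%E).
    apply: ge0_subset_integral; [exact: mc|exact: mall|exact: gs|by []|].
    move=> t vt; have [ct|nct] := pselect ((c false `|` c true) t); first by right.
    by left.
  apply: le_trans.
    by apply: ge0_integral_setU_le => //; exact: gs.
  apply: leeD.
    apply: (@le_trans _ _ (\int[@lebesgue_measure R]_(t in mid)
        (f t * cascade_density hb V w N t)%:E)%E).
      rewrite le_eqVlt; apply/orP; left; apply/eqP; apply: eq_integral => t.
      rewrite inE => -[vt ncc]; rewrite /g /f cell_minus_edges ?mul1r//.
        by move=> c0; apply: ncc; left.
      by move=> c1; apply: ncc; right.
    by apply: ge0_subset_integral.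
  apply: ge0_integral_setU_le => //; [exact: mc|exact: mc|exact: gs].
have c1 := @Icc_cvg w _ cf.
have c2 : (\int[@lebesgue_measure R]_(t in `[0%R, 1%R])
     (f t * cascade_density hb V w (size v + p + k) t)%:E)%E @[k --> \oo] -->
     (\int[m w]_(t in `[0%R, 1%R]) (f t)%:E)%E.
  exact: (cvg_comp (addn (size v + p)) _ (@cvg_addnl (size v + p)) c1).
have tc z : total_wt V k z @[k --> \oo] --> M z by exact: total_wt_cvg.
have c3 : (wt V w v * total_wt V (p + k) (w ++ v) -
    (wt V w (edge_word v false p) * total_wt V k (w ++ edge_word v false p) +
     wt V w (edge_word v true p) * total_wt V k (w ++ edge_word v true p)))%:E
   @[k --> \oo] --> (wt V w v * M (w ++ v) -
    (wt V w (edge_word v false p) * M (w ++ edge_word v false p) +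
     wt V w (edge_word v true p) * M (w ++ edge_word v true p)))%:E.
  apply: cvg_EFin; first by apply: nearW.
  apply: cvgB.
    apply: cvgM; first exact: cvg_cst.
    exact: (cvg_comp (addn p) (fun k => total_wt V k (w ++ v)) (@cvg_addnl p) (tc _)).
  by apply: cvgD; (apply: cvgM; [exact: cvg_cst|exact: tc]).
have lim := lee_cvg_to c3 c2 (nearW _ step).
apply: (le_trans (lim _ _)).
have mO : measurable (`]left_end R v, right_end R v[%classic : set (measurableTypeR R)).
  exact: measurable_itv.
apply: (@le_trans _ _ (\int[m w]_(t in `[0%R, 1%R])
   (\1_(`]left_end R v, right_end R v[%classic) t)%:E)%E).
  apply: ge0_le_integral => //.
  - by move=> t _; rewrite lee_fin bump_ge0.
  - by apply/measurable_EFinP; exact: measurable_funTS.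
  - by apply/measurable_EFinP; apply: measurable_indic.
  - by move=> t _; rewrite lee_fin bump_le_indic.
rewrite integral_indic//; apply: le_measure; rewrite ?inE//; exact: measurableI.
Qed.

(** This is what rules out atoms at end points; for the cascade it follows from the bound [r < 1] on
    the weights and the logarithmic bound on the masses. *)
Hypothesis edge_cvg0 : forall w v e,
  wt V w (edge_word v e p) * M (w ++ edge_word v e p) @[p --> \oo] --> 0.

Lemma open_cell_mass_ge w v :
  ((wt V w v * M (w ++ v))%:E <= m w `]left_end R v, right_end R v[%classic)%E.
Proof.
rewrite -(@fineK _ (m w _)) ?fin_num_measure// lee_fin.
set F := fine _; set c := wt V w v * _.
have h : (c - (wt V w (edge_word v false p) * M (w ++ edge_word v false p) +
     wt V w (edge_word v true p) * M (w ++ edge_word v true p))) @[p --> \oo] --> c.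
  rewrite -[X in _ --> X]subr0 -[X in _ --> _ - X]addr0.
  apply: cvgB; first exact: cvg_cst.
  by apply: cvgD; exact: edge_cvg0.
rewrite -(cvg_lim _ h)//; apply: limr_le; first exact: (cvgP _ h).
apply: nearW => p.
rewrite -lee_fin /F fineK ?fin_num_measure//.
exact: open_cell_mass_ge_edges.
Qed.

Lemma word_intervalE v : @word_interval R b v = `[left_end R v, right_end R v]%classic.
Proof. by []. Qed.

Lemma open_cell_word_interval_disjoint (v v' : seq 'I_b) t :
  size v = size v' -> v != v' ->
  `]left_end R v', right_end R v'[%classic t -> ~ @word_interval R b v t.
Proof.
move=> sv vv'; rewrite word_intervalE /= !in_itv /= => /andP[h1 h2] /andP[h3 h4].
have h5 : left_end R v' < right_end R v by apply: lt_le_trans h4.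
have h6 : left_end R v < right_end R v' by apply: le_lt_trans h2.
have bn0 : 0 < b%:R ^- size v' :> R by rewrite invr_gt0 exprn_gt0.
rewrite /left_end /right_end sv !ltr_pM2r// !ltr_nat !ltnS in h5 h6.
move/eqP: vv'; apply; apply: (word_index_inj hb sv).
by apply/eqP; rewrite eqn_leq h5 h6.
Qed.

(* The open cells of generation [size v] other than that of v are disjoint from
   the closed cell of v, and their masses are at least the expected ones, which
   add up to the total mass; so the closed cell of v has no excess mass, and in
   particular its end points are not atoms. *)
Lemma word_interval_mass w v : m w (@word_interval R b v) = (wt V w v * M (w ++ v))%:E.
Proof.
apply/eqP; rewrite eq_le; apply/andP; split; last first.
  apply: (le_trans (open_cell_mass_ge w v)); apply: le_measure; rewrite ?inE.
  - exact: measurable_itv.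
  - exact: measurable_itv.
  - by move=> t; rewrite word_intervalE /= !in_itv /= => /andP[/ltW-> /ltW->].
pose n := size v; pose vt : n.-tuple 'I_b := in_tuple v.
pose O (z : seq 'I_b) : set (measurableTypeR R) := `]left_end R z, right_end R z[%classic.
pose G (z : n.-tuple 'I_b) : set (measurableTypeR R) :=
  if z == vt then @word_interval R b v else O z.
have mG z : measurable (G z).
  by rewrite /G; case: ifP => _; exact: measurable_itv.
have Ov (z : n.-tuple 'I_b) t : z != vt -> O z t -> ~ @word_interval R b v t.
  move=> zv; apply: open_cell_word_interval_disjoint; first by rewrite size_tuple.
  by apply: contraNneq zv => vz; apply/eqP/val_inj.
have OO (z z' : n.-tuple 'I_b) t : z != z' -> O z t -> O z' t -> False.
  move=> zz' Oz Oz'; have : ~ @word_interval R b z' t.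
    apply: (open_cell_word_interval_disjoint _ _ Oz); first by rewrite !size_tuple.
    by apply: contraNneq zz' => h; apply/eqP/val_inj.
  apply; move: Oz'; rewrite /O word_intervalE /= !in_itv /=.
  by move=> /andP[/ltW-> /ltW->].
have tG : trivIset setT G.
  move=> z z' _ _ [t []]; rewrite /G.
  case: eqVneq => [->|zv]; case: eqVneq => [->|z'v] // h h'.
  - by case: (Ov _ _ z'v h').
  - by case: (Ov _ _ zv h).
  - by apply: contrapT => /eqP zz'; exact: (OO _ _ _ zz' h h').
have GI z : G z `<=` `[0%R, 1%R].
  have wI (u : seq 'I_b) : @word_interval R b u `<=` `[0%R, 1%R].
    move=> t; rewrite word_intervalE /= !in_itv /= => /andP[h1 h2].
    apply/andP; split.
      by apply: le_trans h1; rewrite divr_ge0// exprn_ge0.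
    apply: (le_trans h2); rewrite /right_end ler_pdivrMr ?exprn_gt0// mul1r.
    by rewrite -natrX ler_nat word_index_lt.
  move=> t; rewrite /G; case: ifP => _; first exact: wI.
  rewrite /O /= in_itv /= => /andP[/ltW h1 /ltW h2]; apply: (wI z).
  by rewrite word_intervalE /= in_itv /= h1 h2.
have le1 : (\sum_(z : n.-tuple 'I_b) m w (G z) <= mass (m w))%E.
  rewrite fsbig_seq ?index_enum_uniq// -measure_fin_bigcup//.
  - apply: le_measure; rewrite ?inE; last by move=> t [z _ /GI].
      by apply: fin_bigcup_measurable.
    exact: measurable_itv.
  - by move=> z z' _ _; exact: tG.
have le2 : (m w (@word_interval R b v) + \sum_(z : n.-tuple 'I_b | z != vt)
    (wt V w z * M (w ++ z))%:E <= mass (m w))%E.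
  apply: le_trans le1; rewrite [leRHS](bigD1 vt)//= {1}/G eqxx leeD2l//.
  apply: lee_sum => z /negbTE zv; rewrite /G zv.
  exact: open_cell_mass_ge.
have Mw := mass_cat w n; rewrite (bigD1 vt)//= in Mw.
move: le2; rewrite sumEFin mass_fin Mw.
rewrite -(@fineK _ (m w _)) ?fin_num_measure//.
  by rewrite -EFinD !lee_fin lerD2r.
exact: measurable_itv.
Qed.

End weak_limit_cells.

(** * ** From the masses to the structure function *)

Section path_estimates.
Context (R : realType) (b : nat).
Implicit Types (w v : seq 'I_b).

Lemma wt_normalized (omega : seq 'I_b -> 'I_b -> R) (q c : R) w v :
  (forall u i, 0 < omega u i) -> c != 0 ->
  wt omega w v `^ q = c ^+ size v * wt (fun u i => omega u i `^ q / c) w v.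
Proof.
move=> o0 c0; elim: v w => [|i v IHv] w /=; first by rewrite powR1 mul1r.
rewrite powRM ?(ltW (o0 _ _))//; last exact/ltW/wt_gt0.
by rewrite IHv exprS mulrACA [_ * (_ / c)]mulrC divfK.
Qed.

(** With c^n factored out, [S] and [Mq w] are sums with the same weights, of y^q and of [Mq]
    respectively. Term by term these differ by a factor of at most exp(Q L) exp(L). *)
Lemma ln_structure_sum (omega : seq 'I_b -> 'I_b -> R) (y Mq : seq 'I_b -> R)
    (q c Q L : R) (w : seq 'I_b) (n : nat) : (0 < b)%N ->
  (forall u i, 0 < omega u i) -> 0 < c -> `|q| <= Q -> 0 <= L ->
  Mq w = \sum_(v : n.-tuple 'I_b) wt (fun u i => omega u i `^ q / c) w v * Mq (w ++ v) ->
  (forall v : n.-tuple 'I_b, expR (- L) <= y (w ++ v) <= expR L) ->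
  (forall v : n.-tuple 'I_b, expR (- L) <= Mq (w ++ v) <= expR L) ->
  let S := \sum_(v : n.-tuple 'I_b) (wt omega w v * y (w ++ v)) `^ q in
  [/\ 0 < S, 0 < Mq w &
  `|ln S - (n%:R * ln c + ln (Mq w))| <= (Q + 1) * L].
Proof.
move=> b0 o0 c0 qQ L0 Mw yL ML S.
pose V u i := omega u i `^ q / c.
have V0 u i : 0 < V u i by rewrite divr_gt0 ?powR_gt0.
have {}Mw : Mq w = \sum_(v : n.-tuple 'I_b) wt V w v * Mq (w ++ v) by [].
have M0 (v : n.-tuple 'I_b) : 0 < Mq (w ++ v).
  by have /andP[+ _] := ML v; apply: lt_le_trans; exact: expR_gt0.
have y0 (v : n.-tuple 'I_b) : 0 < y (w ++ v).
  by have /andP[+ _] := yL v; apply: lt_le_trans; exact: expR_gt0.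
have wt0 v : 0 < wt V w v by apply: wt_gt0.
have SE : S = c ^+ n * \sum_(v : n.-tuple 'I_b) wt V w v * y (w ++ v) `^ q.
  rewrite /S mulr_sumr; apply: eq_bigr => v _.
  rewrite powRM ?(ltW (y0 _))//; last exact/ltW/wt_gt0.
  by rewrite (wt_normalized q w v o0 (lt0r_neq0 c0)) size_tuple mulrA.
have lny (v : n.-tuple 'I_b) : `|q * ln (y (w ++ v))| <= Q * L.
  rewrite normrM ler_pM// ler_norml; have /andP[h1 h2] := yL v.
  rewrite -[X in X <= _ <= _]expRK -[X in _ <= _ <= X]expRK.
  by rewrite !ler_ln ?posrE ?expR_gt0// h1.
have yq (v : n.-tuple 'I_b) : expR (- (Q * L)) <= y (w ++ v) `^ q <= expR (Q * L).
  rewrite /powR gt_eqF// !ler_expR -ler_norml; exact: lny.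
have sumpos (f : n.-tuple 'I_b -> R) : (forall z, 0 < f z) -> 0 < \sum_z f z.
  move=> f0; have f0' z : 0 <= f z by exact: ltW.
  rewrite lt0r sumr_ge0// andbT psumr_neq0//; apply/hasP.
  by exists [tuple of nseq n (Ordinal b0)]; rewrite ?mem_index_enum//= f0.
have Mw0 : 0 < Mq w by rewrite Mw; apply: sumpos => v; rewrite mulr_gt0.
have S0 : 0 < S by apply: sumpos => v; rewrite powR_gt0// mulr_gt0// wt_gt0.
split => //.
pose Sig := \sum_(v : n.-tuple 'I_b) wt V w v * y (w ++ v) `^ q.
have Sig0 : 0 < Sig by apply: sumpos => v; rewrite mulr_gt0// powR_gt0.
have -> : ln S - (n%:R * ln c + ln (Mq w)) = ln Sig - ln (Mq w).
  by rewrite SE lnM ?posrE ?exprn_gt0// lnXn// mulr_natl; ring.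
have e1 : (Q + 1) * L = Q * L + L by ring.
have hi : Sig <= expR ((Q + 1) * L) * Mq w.
  rewrite Mw mulr_sumr; apply: ler_sum => v _.
  rewrite mulrCA ler_pM2l// e1 expRD -mulrA.
  have /andP[_ h1] := yq v; have /andP[h2 _] := ML v.
  apply: (le_trans h1); rewrite -[leLHS]mulr1 ler_pM2l ?expR_gt0//.
  by rewrite mulrC -ler_pdivrMr ?expR_gt0// mul1r -expRN.
have lo : expR (- ((Q + 1) * L)) * Mq w <= Sig.
  rewrite Mw mulr_sumr; apply: ler_sum => v _.
  rewrite mulrCA ler_pM2l// e1 opprD expRD -mulrA.
  have /andP[h1 _] := yq v; have /andP[_ h2] := ML v.
  apply: le_trans h1; rewrite -[leRHS]mulr1 ler_pM2l ?expR_gt0//.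
  by rewrite expRN ler_pdivrMl ?expR_gt0// mulr1.
rewrite ler_norml; apply/andP; split.
  rewrite lerBrDr -[X in X + _]expRK -lnM ?posrE ?expR_gt0//.
  by rewrite ler_ln ?posrE ?mulr_gt0 ?expR_gt0.
rewrite lerBlDr -[X in X + _]expRK -lnM ?posrE ?expR_gt0//.
by rewrite ler_ln ?posrE ?mulr_gt0 ?expR_gt0.
Qed.

End path_estimates.

(** The logarithm lies below a line of arbitrarily small slope; the slope is chosen so that the
    power of [k + p] uses up half of the geometric decay. *)
Lemma exp_ln_geometric_cvg0 (R : realType) (r theta : R) (k : nat) :
  0 < r < 1 -> 0 < theta ->
  r ^+ p * expR (theta * ln (k + p)%:R) @[p --> \oo] --> 0.
Proof.
move=> /andP[r0 r1] th0.
pose l := - ln r / 2.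
have l0 : 0 < l by rewrite divr_gt0// oppr_gt0 ln_lt0// r0.
pose e := l / theta; have e0 : 0 < e by rewrite divr_gt0.
pose C := expR (l * k%:R - theta * ln e).
have rho1 : `|expR (- l)| < 1 by rewrite ger0_norm ?expR_ge0// expR_lt1; lra.
have cg := @cvg_geometric R C (expR (- l)) rho1.
apply: (squeeze_cvgr _ (cvg_cst 0) cg).
near=> p; apply/andP; split; first by rewrite mulr_ge0 ?expR_ge0 ?exprn_ge0 ?(ltW r0).
have p0 : (0 < p)%N by near: p; exact: nbhs_infty_gt.
have N0 : 0 < (k + p)%:R :> R by rewrite ltr0n addn_gt0 p0 orbT.
rewrite /geometric/= /C -expRM_natl -expRD -[r ^+ p]lnK ?posrE ?exprn_gt0//.
rewrite -expRD ler_expR lnXn// -[ln r *+ p]mulr_natl.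
have h : ln (k + p)%:R <= e * (k + p)%:R - ln e.
  rewrite lerBrDr -lnM ?posrE// mulrC; apply: ltW; apply: ln_sublinear.
  by rewrite mulr_gt0.
have h2 : theta * ln (k + p)%:R <= l * (k + p)%:R - theta * ln e.
  apply: (@le_trans _ _ (theta * (e * (k + p)%:R - ln e))).
    by rewrite ler_pM2l.
  rewrite mulrBr mulrA /e mulrCA divff ?mulr1// lt0r_neq0//.
have -> : ln r = - 2 * l by rewrite /l; lra.
by move: h2; rewrite natrD; lra.
Unshelve. all: by end_near. Qed.

Lemma expR_bounds_of_cvg (R : realType) (u : nat -> R) (l L : R) :
  u n @[n --> \oo] --> l -> (\forall n \near \oo, 0 < u n /\ `|ln (u n)| <= L) ->
  expR (- L) <= l <= expR L.
Proof.
move=> ul uL; have h : \forall n \near \oo, expR (- L) <= u n <= expR L.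
  apply: filterS uL => n [u0]; rewrite ler_norml => /andP[h1 h2].
  by rewrite -[u n]lnK ?posrE// !ler_expR h1.
rewrite -(cvg_lim _ ul)//; apply/andP; split.
  apply: limr_ge; first exact: (cvgP _ ul).
  by apply: filterS h => n /andP[].
apply: limr_le; first exact: (cvgP _ ul).
by apply: filterS h => n /andP[].
Qed.

(** Makes [q = 1] the parameter at which the normalized weights are those of the cascade itself. *)
Lemma phi1 (R : realType) (b : nat) (d0 : measure_display) (T0 : measurableType d0)
    (P0 : probability T0 R) (W0 : {mfun T0 >-> b.-tuple (measurableTypeR R)}) :
  {ae P0, forall x, forall k : 'I_b, 0 < (tnth (W0 x) k : R)} ->
  (\sum_(k < b) 'E_P0[fun x => tnth (W0 x) k] = 1)%E -> phi P0 W0 1 = 1.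
Proof.
move=> Wpos W1.
have mk (k : 'I_b) : measurable_fun setT (fun x => (tnth (W0 x) k : R) `^ 1).
  exact: (measurableT_comp (measurable_tnth_powR k 1)).
rewrite /phi -[RHS]/(fine 1%E) -W1; congr fine.
transitivity (\int[P0]_x (\sum_(k < b) ((tnth (W0 x) k : R) `^ 1)%:E))%E.
  by apply: eq_integral => x _; rewrite /moment_sum sumEFin.
rewrite ge0_integral_sum//; last 2 first.
- by move=> k; apply/measurable_EFinP.
- by move=> k x _; rewrite lee_fin powR_ge0.
apply: eq_bigr => k _; rewrite unlock.
apply: ae_eq_integral => //.
- by apply/measurable_EFinP.
- apply/measurable_EFinP.
  exact: (measurableT_comp (@measurable_tnth _ (measurableTypeR R) b k)).
- by move: Wpos; apply: filterS => x Wx _; rewrite powRr1// ltW.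
Qed.

(** [Q] exceeds 1 so that the parameter 1 is covered too, and the right end is excluded because the
    grids consist of left end points of mesh intervals. *)
Lemma compact_sub_itv (R : realType) (K : set R) : compact K ->
  exists2 Q, 1 < Q & forall q, K q -> - Q <= q < Q.
Proof.
move=> /compact_bounded[M [_ hM]]; exists (`|M| + 2).
  by have := normr_ge0 M; lra.
move=> q Kq; have := hM (`|M| + 1) _ q Kq; have := ler_norm M => h1 h2.
have {}h2 : `|q| <= `|M| + 1 by apply: h2; lra.
by move: h2; rewrite ler_norml => /andP[h3 h4]; apply/andP; split; lra.
Qed.

Lemma tau_n_estimate (R : realType) (b n : nat)
    (m : {finite_measure set (measurableTypeR R) -> \bar R})
    (q c S Mw C : R) : (1 < b)%N -> (0 < n)%N -> 0 < c -> 0 < S -> 0 < Mw ->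
  (\sum_(v : n.-tuple 'I_b) poweR (m (@word_interval R b v)) q = S%:E)%E ->
  `|ln S - (n%:R * ln c + ln Mw)| <= C ->
  (`|(- (ln c / ln b%:R))%:E - tau_n b m n q| <=
   `|logb b Mw%:E| * (n%:R^-1)%:E + (C / ln b%:R / n%:R)%:E)%E.
Proof.
move=> hb n0 c0 S0 M0 mS hC.
have lb0 : 0 < ln b%:R :> R by rewrite ln_gt0// ltr1n.
have nR0 : 0 < n%:R :> R by rewrite ltr0n.
rewrite /tau_n mS /logb !lne_EFin// -!EFinM -EFinN -EFinB !abse_EFin -EFinD lee_fin.
have -> : - (ln c / ln b%:R) - - (n%:R^-1 * (ln S / ln b%:R)) =
   ((ln S - (n%:R * ln c + ln Mw)) + ln Mw) / ln b%:R / n%:R.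
  by field; rewrite !lt0r_neq0.
rewrite !normrM !normfV (gtr0_norm lb0) (gtr0_norm nR0).
rewrite -mulrDl ler_pM2r ?invr_gt0// -mulrDl ler_pM2r ?invr_gt0//.
by apply: le_trans (ler_normD _ _) _; rewrite addrC lerD2l.
Qed.

(** The exponent 1/2 gives j <= n^2, and j + n <= n^2 + n <= n^3 as soon as n >= 2. *)
Lemma sqrt_cutoff (R : realType) (j n : nat) : (4 <= j)%N ->
  j%:R `^ (2^-1) <= n%:R :> R ->
  [/\ (1 < n)%N & ln (j + n)%:R <= 3 * ln n%:R :> R].
Proof.
move=> j4; rewrite powR12_sqrt// => h.
have jn : (j <= n ^ 2)%N.
  rewrite -(ler_nat R) natrX -[leLHS]sqr_sqrtr//.
  by rewrite lerXn2r ?nnegrE ?sqrtr_ge0.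
have n1 : (1 < n)%N.
  by case: n jn {h} => [|[|n]] jn; rewrite // ?exp0n ?exp1n // in jn; lia.
split => //; rewrite mulr_natl -lnXn ?ltr0n ?(ltnW n1)//.
rewrite ler_ln ?posrE ?exprn_gt0 ?ltr0n ?addn_gt0 ?(ltnW n1) ?orbT//.
rewrite -natrX ler_nat; nia.
Qed.

Unset Implicit Arguments.

Theorem theorem5 (R : realType) (b : nat) (hb : (1 < b)%N)
  (d0 d : measure_display) (T0 : measurableType d0) (T : measurableType d)
  (P0 : probability T0 R) (P : probability T R)
  (W0 : {mfun T0 >-> b.-tuple (measurableTypeR R)})
  (W : seq 'I_b -> {mfun T >-> b.-tuple (measurableTypeR R)})
  (W0_gt0 : {ae P0, forall x, forall k : 'I_b, 0 < (tnth (W0 x) k : R)})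
  (W0_mean : (\sum_(k < b) 'E_P0[fun x => tnth (W0 x) k] = 1)%E)
  (W_law : forall (w : seq 'I_b) (B : set (b.-tuple (measurableTypeR R))),
      measurable B -> P (W w @^-1` B) = P0 (W0 @^-1` B))
  (W_indep : mutually_independent P W)
  (mu : seq 'I_b -> T ->
        {finite_measure set (measurableTypeR R) -> \bar R})
  (mu_lim : {ae P, forall x, forall v : seq 'I_b,
      weak_limit (cascade_density hb (fun w i => tnth (W w x) i) v) (mu v x)})
  (muq : R -> seq 'I_b -> T ->
         {finite_measure set (measurableTypeR R) -> \bar R})
  (muq_lim : {ae P, forall x, forall (v : seq 'I_b) (q : R), Jset P0 W0 q ->
      weak_limit
        (cascade_density hb
           (fun w i => b%:R `^ fine (ttau P0 W0 q) * tnth (W w x) i `^ q) v)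
        (muq q v x)})
  (J_full : Jset P0 W0 = setT)
  (W0_bounded : exists A : R, 1 < A /\
      {ae P0, forall x, forall k : 'I_b, A^-1 <= (tnth (W0 x) k : R) <= A})
  (K : set R) (K_compact : compact K) (K_interval : is_interval K) :
  exists theta delta : R, [/\ 0 < theta, 0 < delta < 1 &
    {ae P, forall x,
      (\forall j \near \oo, forall q : R, K q ->
         (`|ttau P0 W0 q - tau_n b (mu [::] x) j q| <=
          `|logb b (mass (muq q [::] x))| * (j%:R^-1)%:E +
          (theta * (ln j%:R / j%:R))%:E)%E)
      /\
      (\forall j \near \oo, forall n : nat, j%:R `^ delta <= (n%:R : R) ->
         forall w : seq 'I_b, size w = j -> forall q : R, K q ->
         (`|ttau P0 W0 q - tau_n b (mu w x) n q| <=
          `|logb b (mass (muq q w x))| * (n%:R^-1)%:E +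
          (theta * (ln n%:R / n%:R))%:E)%E /\
         (`|lne (mass (muq q w x))| <= (theta * ln j%:R)%:E)%E)}].
Proof.
have [A [A1 W0A]] := W0_bounded.
have [Q Q1 KQ] := compact_sub_itv K_compact.
have Q0 : 0 < Q by lra.
have [th th0 hth] := cascade_log_bound hb W_law W_indep J_full A1 W0A Q0.
have [r r01 hr] := weight_sup hb A1 W0A J_full Q0.
have p1 := phi1 W0_gt0 W0_mean.
have lb0 : 0 < ln b%:R :> R by rewrite ln_gt0// ltr1n.
have Q1' : - Q <= 1 <= Q by apply/andP; split; lra.
have hr1 := ae_normalized_weight_le W_law (hr 1 Q1').
(* The factor 3 comes from [sqrt_cutoff] and Q + 1 from [ln_structure_sum]; [th] is added below to
   cover the bound on the logarithm of the masses as well. *)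
pose C0 := 3 * (Q + 1) * th / ln b%:R.
have C00 : 0 < C0 by rewrite divr_gt0// !mulr_gt0//; lra.
exists (th + C0), 2^-1; split; first exact: addr_gt0.
  by apply/andP; split; lra.
apply: filterS2 (filterI mu_lim muq_lim)
  (filterI (filterI (ae_W_bounded W_law W0A) hr1) hth).
move=> x [mux muqx] [[xA x1] xth].
pose omega u i : R := tnth (W u x) i.
have o0 u i : 0 < omega u i.
  have /andP[+ _] := xA u i; apply: lt_le_trans.
  by rewrite invr_gt0 (lt_trans ltr01).
pose V q u i := omega u i `^ q / phi P0 W0 q.
have ph0 q : 0 < phi P0 W0 q := phi_gt0 hb A1 W0A q.
have V0 q u i : 0 < V q u i by rewrite divr_gt0 ?powR_gt0.
have V1 u i : V 1 u i = omega u i by rewrite /V p1 divr1 powRr1// ltW.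
have Vlim q w : weak_limit (cascade_density hb (V q) w) (muq q w x).
  have := muqx w q; rewrite J_full => /(_ I).
  suff -> : (fun w0 i => b%:R `^ fine (ttau P0 W0 q) * tnth (W w0 x) i `^ q) = V q by [].
  by apply: funext => u; apply: funext => i; rewrite (b_powR_ttau hb A1 W0A) mulrC.
pose Mq q w := fine (mass (muq q w x)).
pose y w := fine (mass (mu w x)).
have massE q w : mass (muq q w x) = (Mq q w)%:E.
  by rewrite /Mq fineK// fin_num_measure.
have V0' q u i : 0 <= V q u i by exact: ltW.
have o0' u i : 0 <= omega u i by exact: ltW.
have Mcvg q w : total_wt (V q) n w @[n --> \oo] --> Mq q w.
  exact: (total_wt_cvg (hb := hb) (m := fun w => muq q w x) (V0' q) (Vlim q)).
have ycvg w : total_wt omega n w @[n --> \oo] --> y w.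
  exact: (total_wt_cvg (hb := hb) (m := fun w => mu w x) o0' mux).
have [j0 _ hj0] := xth.
have near_depth j (u : nat -> R) :
    (forall n, `|u (flat_depth j + n)%N| <= th * ln j%:R) ->
    \forall n \near \oo, `|u n| <= th * ln j%:R.
  move=> h; exists (flat_depth j) => // n /= jn.
  by have := h (n - flat_depth j)%N; rewrite subnKC.
(* The bound holds for all total weights from generation [flat_depth] on, so it passes to their
   limit. *)
have Mbound w q : (j0 <= size w)%N -> - Q <= q < Q ->
    expR (- (th * ln (size w)%:R)) <= Mq q w <= expR (th * ln (size w)%:R).
  move=> jw qQ; apply: (expR_bounds_of_cvg (Mcvg q w)).
  have := @near_depth (size w) (fun n => ln (total_wt (V q) n w)).
  move=> /(_ (hj0 _ jw w erefl q qQ)); apply: filterS => n hn; split => //.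
  exact: total_wt_gt0 (ltnW hb) (V0 q).
have Qy : - Q <= 1 < Q by apply/andP; split; lra.
(* The masses of [mu] and of [muq 1] are limits of the same total weights. *)
have ybound w : (j0 <= size w)%N ->
    expR (- (th * ln (size w)%:R)) <= y w <= expR (th * ln (size w)%:R).
  move=> jw; suff -> : y w = Mq 1 w by exact: Mbound.
  apply: (cvg_unique _ (ycvg w)) => //.
  have -> : (fun n => total_wt omega n w) = (fun n => total_wt (V 1) n w).
    by apply/funext => n; apply: eq_bigr => v _; apply: eq_wt => u i; rewrite V1.
  exact: Mcvg.
(* The weight of an edge word is at most r^p, by [weight_sup] at [q = 1], while the mass below it
   grows at most like a power of the length of the word. *)
have edge w v e : wt omega w (edge_word hb v e p) * y (w ++ edge_word hb v e p)
    @[p --> \oo] --> 0.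
  have c := exp_ln_geometric_cvg0 (size w + size v) r01 th0.
  apply: (squeeze_cvgr _ (cvg_cst 0) c).
  have r0 : 0 <= r by have /andP[/ltW] := r01.
  exists j0 => // p /= jp.
  have sz : size (edge_word hb v e p) = (size v + p)%N by rewrite size_cat size_nseq.
  have yb := @ybound (w ++ edge_word hb v e p).
  rewrite size_cat sz addnA in yb.
  have {yb}/andP[y1 y2] := yb (leq_trans jp (leq_addl _ _)).
  have y0 := le_trans (expR_ge0 _) y1.
  have or u i : 0 <= omega u i <= r.
    rewrite o0'/= -V1; exact: x1.
  have /andP[w1 w2] := wt_bounds w (edge_word hb v e p) (lexx 0) or.
  have w0 : 0 <= wt omega w (edge_word hb v e p) by exact: wt_ge0.
  rewrite mulr_ge0//= ler_pM//; apply: (le_trans w2).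
  rewrite sz; apply: ler_wiXn2l => //; first by have /andP[_ /ltW] := r01.
  exact: leq_addl.
have mI w v : mu w x (@word_interval R b v) = (wt omega w v * y (w ++ v))%:E.
  exact: (word_interval_mass (hb := hb) (m := fun w => mu w x) o0' mux edge).
(* Covers both assertions: the empty [w] with [n = j] for the first, [w] of length [j] for the
   second. Only the words [w ++ v] have to be long, so no bound on the mass at [w] enters. *)
have main w n q : (0 < n)%N -> (j0 <= size w + n)%N -> K q ->
  0 < Mq q w /\ (`|ttau P0 W0 q - tau_n b (mu w x) n q| <=
    `|logb b (mass (muq q w x))| * (n%:R^-1)%:E +
    ((Q + 1) * (th * ln (size w + n)%:R) / ln b%:R / n%:R)%:E)%E.
  move=> n0 jn Kq; have qQ := KQ q Kq.
  pose L := th * ln (size w + n)%:R.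
  have L0 : 0 <= L.
    by rewrite mulr_ge0 ?(ltW th0)// ln_ge0// ler1n addn_gt0 n0 orbT.
  have absq : `|q| <= Q by rewrite ler_norml; have /andP[-> /ltW] := qQ.
  have yL (v : n.-tuple 'I_b) : expR (- L) <= y (w ++ v) <= expR L.
    by have := @ybound (w ++ v); rewrite size_cat size_tuple; apply.
  have ML (v : n.-tuple 'I_b) : expR (- L) <= Mq q (w ++ v) <= expR L.
    by have := @Mbound (w ++ v) q; rewrite size_cat size_tuple; apply.
  have Mw : Mq q w = \sum_(v : n.-tuple 'I_b) wt (V q) w v * Mq q (w ++ v).
    exact: (mass_cat (hb := hb) (m := fun w => muq q w x) (V0' q) (Vlim q)).
  have [S0 M0 hS] := ln_structure_sum (ltnW hb) o0 (ph0 q) absq L0 Mw yL ML.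
  split => //; rewrite (ttauE hb A1 W0A) massE.
  apply: tau_n_estimate hS => //.
  by rewrite -sumEFin; apply: eq_bigr => v _; rewrite mI poweR_EFin.
split.
  exists (maxn j0 1) => // j /=; rewrite geq_max => /andP[jj j1] q Kq.
  have [_ h] := @main [::] j q j1 jj Kq.
  apply: (le_trans h); rewrite leeD2l// lee_fin add0n mulrA ler_pM2r ?invr_gt0 ?ltr0n//.
  have l0 : 0 <= ln j%:R :> R by rewrite ln_ge0// ler1n.
  have -> : (Q + 1) * (th * ln j%:R) / ln b%:R = (C0 / 3) * ln j%:R.
    by rewrite /C0; field; rewrite lt0r_neq0.
  by rewrite ler_wpM2r//; lra.
exists (maxn j0 4) => // j /=; rewrite geq_max => /andP[jj j4] n jn w wj q Kq.
have [n1 hn] := sqrt_cutoff j4 jn.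
have n0 : (0 < n)%N by exact: ltnW.
have jN : (j0 <= size w + n)%N by rewrite wj (leq_trans jj)// leq_addr.
have [M0 h] := main w n q n0 jN Kq; split.
  apply: (le_trans h); rewrite leeD2l// lee_fin mulrA ler_pM2r ?invr_gt0 ?ltr0n//.
  have l0 : 0 <= ln n%:R :> R by rewrite ln_ge0// ler1n.
  apply: (@le_trans _ _ (C0 * ln n%:R)); last by rewrite ler_wpM2r//; lra.
  have -> : C0 * ln n%:R = (Q + 1) * (th * (3 * ln n%:R)) / ln b%:R.
    by rewrite /C0; field; rewrite lt0r_neq0.
  rewrite ler_pM2r ?invr_gt0// ler_pM2l; last by lra.
  by rewrite ler_pM2l// wj.
rewrite massE lne_EFin// abse_EFin lee_fin.
have jw : (j0 <= size w)%N by rewrite wj.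
have := Mbound w q jw (KQ q Kq); rewrite wj => /andP[h1 h2].
have l0 : 0 <= ln j%:R :> R by rewrite ln_ge0// ler1n (leq_trans _ j4).
apply: (@le_trans _ _ (th * ln j%:R)); last first.
  by rewrite ler_wpM2r// lerDl ltW.
rewrite ler_norml -[X in X <= _ <= _]expRK -[X in _ <= _ <= X]expRK.
by rewrite !ler_ln ?posrE ?expR_gt0// h1.
Qed.
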